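(* Let $\Omega\subset\mathbb R^{n+1}$ be a bounded domain of class $C^2$ with boundary $S=\partial\Omega$ and $\beta\in C^1(S,(0,\pi))$. Let $V\in\mathbf V^m_\beta(\Omega)\cap\mathbf{RV}^m(\overline\Omega)$ with $\mathbf H\in L^p(\mu_V)$ for some $p\in[1,\infty)$. Let $h$ be a non-negative $C^1$-function on $\overline\Omega$. For any $\xi\in\Omega$, and for either every $0<r_1<r_2<\infty$ when $h|_S\equiv0$, or every $0<r_1<r_2<d_S(\xi)$, there holds $$\frac1{r_1^m}\int_{B_{r_1}(\xi)}h\,d\mu_V\le\frac1{r_2^m}\int_{B_{r_2}(\xi)}h\,d\mu_V+\int_{r_1}^{r_2}\frac1{\rho^m}\int_{B_\rho(\xi)}\big(h|\mathbf H|+|\nabla^Vh|\big)d\mu_V\,d\rho-\int_{B_{r_2}(\xi)\setminus B_{r_1}(\xi)}h(x)\frac{|(x-\xi)^\perp|^2}{|x-\xi|^{m+2}}d\mu_V$$ $$\le\frac1{r_2^m}\int_{B_{r_2}(\xi)}h\,d\mu_V+\int_{r_1}^{r_2}\frac1{\rho^m}\int_{B_\rho(\xi)}\big(h|\mathbf H|+|\nabla^Vh|\big)d\mu_V\,d\rho.$$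
   Context: Notation: $n\ge2$, $m\in\mathbb N$, $1\le m\le n$. $B_r(x)$ is the closed ball in $\mathbb R^{n+1}$. $d_S$ is the signed distance function to $S$, positive in $\Omega$. $G(m,n+1)$ is the Grassmannian of unoriented $m$-dimensional linear subspaces of $\mathbb R^{n+1}$; for a plane $P$ and a vector $v$, $P(v)$ is the orthogonal projection of $v$ onto $P$. $G_m(U)=U\times G(m,n+1)$. $\nu^S$ is the inward pointing unit normal along $S$. An $m$-varifold on $\overline\Omega$ is a positive Radon measure $V$ on $G_m(\overline\Omega)$; $\mu_V$ is its push-forward to $\overline\Omega$; $\delta V(\varphi)=\int_{G_m(\overline\Omega)}\mathrm{div}_P\varphi(x)\,dV(x,P)$. $\mathfrak X_t(\Omega)=\{\varphi\in C^1(\overline\Omega,\mathbb R^{n+1}):\varphi(x)\in T_xS\ \forall x\in S\}$. $\mathbf{RV}^m(\overline\Omega)$ is the set of rectifiable varifolds $V=\theta\mathcal H^m\llcorner M\otimes\delta_{T_xM}$ on $\overline\Omega$ ($M$ $m$-rectifiable, $\theta>0$ locally $\mathcal H^m$-integrable on $M$, $T_xM$ the approximate tangent space). For such $V$, $\nabla^Vh(x)$ is the orthogonal projection of $\nabla h(x)$ onto $T_xM$ and $(x-\xi)^\perp$ is the orthogonal projection of $x-\xi$ onto $(T_xM)^\perp$. Capillary bundle: for $x\in S$, $G_{m,\beta}(x)$ is the set of $P\in G(m,n+1)$ with (i) $|P(\nu^S(x))|=\sin\beta(x)$ and (ii) $(P\cap T_xS)\perp P(\nu^S(x))$. $G_{m,\beta}(S)=\{(x,P):x\in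 S,P\in G_{m,\beta}(x)\}$ with the subspace topology of $S\times G(m,n+1)$. For $(x,P)\in G_{m,\beta}(S)$, $\mathbf n(x,P)=P(\nu^S(x))/|P(\nu^S(x))|$. Capillary varifolds: $V\in\mathbf V^m_\beta(\Omega)$ means: $V$ is an $m$-varifold on $\overline\Omega$ and there are a Radon measure $\Gamma$ on $G_{m,\beta}(S)$ (the boundary varifold) and a generalized mean curvature vector $\mathbf H\in L^1_{\rm loc}(\mu_V)$ with values in $\mathbb R^{n+1}$, $\mathbf H(x)\in T_xS$ for $\mu_V$-a.e. $x\in S$, such that for all compactly supported $\varphi\in\mathfrak X_t(\Omega)$: $\delta V(\varphi)=-\int_{\overline\Omega}\langle\mathbf H,\varphi\rangle d\mu_V-\int_{G_{m,\beta}(S)}\langle\mathbf n(x,P),\varphi(x)\rangle d\Gamma(x,P)$. *)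

(* Defs.v *)
From HB Require Import structures.
From mathcomp Require Import all_boot all_order all_algebra.
From mathcomp Require Import all_classical all_reals all_analysis.

Set Implicit Arguments.
Unset Strict Implicit.
Unset Printing Implicit Defensive.

Import Order.TTheory GRing.Theory Num.Theory.
Import numFieldNormedType.Exports.

Local Open Scope classical_set_scope.
Local Open Scope ring_scope.

(* The norm carried by ['rV[R]_N] in the library is the sup norm; it has the
   same topology (hence the same compact sets, limits and derivatives) as the
   Euclidean norm [enorm], which is used wherever distances are measured. *)
Section euclidean.
Context {R : realType} {N : nat}.
Implicit Types (u v x : 'rV[R]_N) (A : set 'rV[R]_N).

Definition dot u v : R := (u *m v^T) 0 0.

Definition enorm u : R := Num.sqrt (dot u u).

Definition eball x (r : R) : set 'rV[R]_N := [set y | enorm (y - x) <= r].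

Definition edist x A : R := inf [set enorm (x - y) | y in A].

(* Zero is added so that the empty set has diameter 0 rather than -oo. *)
Definition ediam A : \bar R :=
  ereal_sup (0%E |` [set (enorm (p.1 - p.2))%:E | p in A `*` A]).

End euclidean.

Section smoothness.
Context {R : realType} {V W : normedModType R}.

Definition C1 (f : V -> W) : Prop :=
  (forall x, differentiable f x) /\ forall v, continuous (fun x => 'd f x v).

(* [f] is of class C^1 on the closure of the open set [A]: it is differentiable
   in [A], and [f] and its derivative extend continuously to the closure; [df]
   is that extension of the derivative, so it is determined on the closure. *)
Definition C1_closure (A : set V) (f : V -> W) (df : V -> V -> W) : Prop :=
  [/\ {within closure A, continuous f},
      forall x, A x -> is_diff x f (df x) &
      forall v, {within closure A, continuous (fun x => df x v)}].

End smoothness.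

Definition C2 {R : realType} {V W : normedModType R} (f : V -> W) : Prop :=
  C1 f /\ forall v, C1 (fun x => 'd f x v).

Section hausdorff.
Context {R : realType} {N : nat}.
Implicit Types A : set 'rV[R]_N.
Local Open Scope ereal_scope.

(* Volume of the unit ball of R^m. *)
Fixpoint unit_ball_volume (m : nat) : R :=
  match m with
  | 0 => 1%R
  | 1 => 2%R
  | m'.+2 => (2 * pi / m%:R * unit_ball_volume m')%R
  end.

(* The value at the empty set matters only for m = 0, where 0 ^+ 0 = 1. *)
Definition hausdorff_gauge (m : nat) A : \bar R :=
  if A == set0 then 0
  else (unit_ball_volume m)%:E * (ediam A * (2^-1)%:E) ^+ m.

Definition hausdorff_cover (delta : R) A : set ((set 'rV[R]_N)^nat) :=
  [set C | A `<=` \bigcup_k C k /\ forall k, ediam (C k) <= delta%:E].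

Definition hausdorff_pre (m : nat) (delta : R) A : \bar R :=
  ereal_inf [set \sum_(k <oo) hausdorff_gauge m (C k)
            | C in hausdorff_cover delta A].

Definition hausdorff (m : nat) A : \bar R :=
  ereal_sup [set hausdorff_pre m delta A | delta in [set d : R | (0 < d)%R]].

Lemma unit_ball_volume_ge0 m : (0 <= unit_ball_volume m)%R.
Proof.
suff : (0 <= unit_ball_volume m /\ 0 <= unit_ball_volume m.+1)%R by case.
elim: m => [|m [IH0 IH1]]; first by split => /=.
split => //=; rewrite mulr_ge0// divr_ge0// mulr_ge0//; exact: pi_ge0.
Qed.

Lemma ediam_ge0 A : 0 <= ediam A.
Proof. by apply: ereal_sup_ubound; left. Qed.

Lemma ediam0 : ediam (set0 : set 'rV[R]_N) = 0.
Proof.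
apply/eqP; rewrite eq_le ediam_ge0 andbT.
by apply: ge_ereal_sup => _ [->//|[p [[]]]].
Qed.

Lemma hausdorff_gauge_ge0 m A : 0 <= hausdorff_gauge m A.
Proof.
rewrite /hausdorff_gauge; case: ifPn => // _.
apply: mule_ge0; first by rewrite lee_fin unit_ball_volume_ge0.
by apply: expe_ge0; apply: mule_ge0; [exact: ediam_ge0|rewrite lee_fin].
Qed.

Lemma hausdorff_pre_ge0 m delta A : 0 <= hausdorff_pre m delta A.
Proof.
apply: le_ereal_inf_tmp => _ [C _ <-].
by apply: nneseries_ge0 => k _ _; exact: hausdorff_gauge_ge0.
Qed.

Lemma hausdorff_pre0 m delta : (0 < delta)%R ->
  hausdorff_pre m delta set0 = 0.
Proof.
move=> d0; apply/eqP; rewrite eq_le hausdorff_pre_ge0 andbT.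
apply: ereal_inf_lbound; exists (fun=> set0).
  by split => // k; rewrite ediam0 lee_fin ltW.
by apply: eseries0 => k _ _; rewrite /hausdorff_gauge eqxx.
Qed.

Lemma le_hausdorff_pre m delta :
  {homo hausdorff_pre m delta : A B / A `<=` B >-> A <= B}.
Proof.
move=> A B AB; apply/ereal_inf_le_tmp => _ [C [BC Cd] <-].
by exists C => //; split => //; exact: subset_trans AB BC.
Qed.

Lemma hausdorff_pre_sigma_subadditive m delta :
  sigma_subadditive (hausdorff_pre m delta).
Proof.
set q := hausdorff_gauge m; set mu := hausdorff_pre m delta.
have q0 X : 0 <= q X by exact: hausdorff_gauge_ge0.
have mu0 X : 0 <= mu X by exact: hausdorff_pre_ge0.
move=> A; have [[i ioo]|] := pselect (exists i, mu (A i) = +oo).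
  rewrite (eseries_pinfty _ _ ioo) ?leey// => n _.
  by rewrite -ltNye (lt_le_trans _ (mu0 _)).
rewrite -forallNE => Aoo.
suff add2e (e : {posnum R}) :
    mu (\bigcup_n A n) <= \sum_(i <oo) mu (A i) + e%:num%:E.
  by apply/lee_addgt0Pr => _/posnumP[].
rewrite (le_trans _ (epsilon_trick _ _ _))//.
pose P n (B : (set 'rV[R]_N)^nat) := hausdorff_cover delta (A n) B /\
  \sum_(k <oo) q (B k) <= mu (A n) + (e%:num / (2 ^ n.+1)%:R)%:E.
have [G PG] : {G : ((set 'rV[R]_N)^nat)^nat & forall n, P n (G n)}.
  apply: (@choice _ _ P) => n; rewrite /P /mu /hausdorff_pre.
  set S := (X in ereal_inf X); move infS : (ereal_inf S) => iS.
  case: iS infS => [r Sr|Soo|Soo].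
  - have en1 : (0 < e%:num / (2 ^ n.+1)%:R)%R by [].
    have /(lb_ereal_inf_adherent en1) : ereal_inf S \is a fin_num by rewrite Sr.
    move=> [x [B AnB muBx] xS].
    by exists B; split => //; rewrite muBx -Sr; exact/ltW.
  - by have := Aoo n; rewrite /mu /hausdorff_pre Soo.
  - suff : lbound S 0 by move/le_ereal_inf_tmp; rewrite Soo.
    by move=> /= _ [B AnB <-]; exact: nneseries_ge0.
have qG_ge0 x : 0 <= (q \o uncurry G) x by exact: q0.
apply: (@le_trans _ _ (\esum_(i in setT) (q \o uncurry G) i)).
  apply: ereal_inf_lbound => /=.
  have /card_esym/ppcard_eqP[f] := card_nat2.
  exists (uncurry G \o f).
    split => [t [i _ /((PG i).1.1) [j _ Bijt]]|k].
      by exists (f^-1%FUN (i, j)) => //=; rewrite invK ?inE.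
    by rewrite /=; case: (f k) => i j; exact: (PG i).1.2.
  rewrite -(esum_pred_image (q \o uncurry G) _ xpredT) ?[fun=> _]set_true//.
  by rewrite image_eq.
rewrite (_ : esum _ _ = \sum_(i <oo) \sum_(j <oo ) q (G i j)); last first.
  pose J : nat -> set (nat * nat) := fun i => [set (i, j) | j in setT].
  rewrite (_ : setT = \bigcup_k J k); last first.
    by rewrite predeqE => -[a b]; split => // _; exists a => //; exists b.
  rewrite esum_bigcupT /=; last 2 first.
    - apply/trivIsetP => i j _ _ ij.
      rewrite predeqE => -[n k] /=; split => //= -[] [_] _ [<-{n} _].
      by move=> [k' _] [] /esym/eqP; rewrite (negbTE ij).
    - by move=> /= [n k]; exact: q0.
  rewrite -(image_id [set: nat]) -fun_true esum_pred_image//; last first.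
    by move=> n _; exact: esum_ge0.
  apply: eq_eseriesr => /= j _.
  rewrite -(esum_pred_image (q \o uncurry G) (pair j) predT)//=; last first.
    by move=> ? ? _ _; exact: (@can_inj _ _ _ snd).
  by congr esum; rewrite predeqE => -[a b]; split; move=> [i _ <-]; exists i.
apply: lee_lim.
- apply: is_cvg_nneseries => n *.
  by apply: nneseries_ge0 => k *; exact: (qG_ge0 (n, k)).
- by apply: is_cvg_nneseries => n *; apply: adde_ge0.
- by near=> n; apply: lee_sum => i _; exact: (PG i).2.
Unshelve. all: by end_near. Qed.

Lemma hausdorff0 m : hausdorff m set0 = 0.
Proof.
apply/eqP; rewrite eq_le; apply/andP; split.
  by apply: ge_ereal_sup => _ [d /= d0 <-]; rewrite hausdorff_pre0.
apply: le_trans (hausdorff_pre_ge0 m 1 set0) _.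
by apply: ereal_sup_ubound; exists 1%R => /=.
Qed.

Lemma hausdorff_ge0 m A : 0 <= hausdorff m A.
Proof.
apply: le_trans (hausdorff_pre_ge0 m 1 A) _.
by apply: ereal_sup_ubound; exists 1%R => /=.
Qed.

Lemma le_hausdorff m : {homo hausdorff m : A B / A `<=` B >-> A <= B}.
Proof.
move=> A B AB; apply: ge_ereal_sup => _ [d /= d0 <-].
apply: le_trans (le_hausdorff_pre m d AB) _.
by apply: ereal_sup_ubound; exists d.
Qed.

Lemma hausdorff_sigma_subadditive m : sigma_subadditive (hausdorff m).
Proof.
move=> A; apply: ge_ereal_sup => _ [d /= d0 <-].
apply: le_trans (hausdorff_pre_sigma_subadditive m d A) _.
apply: lee_nneseries => [k _ _|k _ /=]; first exact: hausdorff_pre_ge0.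
by apply: ereal_sup_ubound; exists d.
Qed.

HB.instance Definition _ (m : nat) :=
  isOuterMeasure.Build R 'rV[R]_N (hausdorff m) (hausdorff0 m)
    (hausdorff_ge0 m) (@le_hausdorff m) (@hausdorff_sigma_subadditive m).

Definition hausdorff_outer (m : nat) : {outer_measure set 'rV[R]_N -> \bar R} :=
  hausdorff m.

Definition hausdorff_measure (m : nat) :
    {measure set (caratheodory_type (hausdorff_outer m)) -> \bar R} :=
  (hausdorff_outer m : set (caratheodory_type (hausdorff_outer m)) -> \bar R).

End hausdorff.
Arguments hausdorff_outer {R} N m.
Arguments hausdorff_measure {R} N m.

HB.instance Definition _ (T U : ptopologicalType) :=
  Topological.on (T * U)%type.

Definition borel (T : ptopologicalType) : Type := g_sigma_algebraType (@open T).

HB.instance Definition _ (T : ptopologicalType) := Measurable.on (borel T).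

Section geometry.
Context {R : realType} {n : nat}.
Local Notation E := 'rV[R]_n.+1.
Local Notation M := 'M[R]_n.+1.
Implicit Types (Omega S : set E) (x v : E) (P : M).

Definition boundary Omega : set E := closure Omega `\` interior Omega.

(* Around each boundary point, after an orthogonal change of coordinates, the
   domain is the part of a ball above the graph of a C^2 function of the first
   n coordinates ([col' ord_max y] is y without its last coordinate). *)
Definition C2_boundary Omega : Prop :=
  forall x0, boundary Omega x0 ->
  exists (r : R) (Q : M) (g : 'rV[R]_n -> R),
    [/\ 0 < r, Q *m Q^T = 1%:M, C2 g &
        forall x, enorm (x - x0) < r ->
          Omega x <-> g (col' ord_max (x *m Q)) < (x *m Q) 0 ord_max].

Definition bounded_C2_domain Omega : Prop :=
  [/\ open Omega, connected Omega, Omega !=set0, bounded_set Omega &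
      C2_boundary Omega].

Definition signed_dist Omega x : R :=
  if x \in Omega then edist x (boundary Omega)
  else - edist x (boundary Omega).

(* Velocities at x of the curves contained in S. *)
Definition tangent_space S x : set E :=
  [set v | exists c : R -> E,
     [/\ c 0 = x, \forall t \near (0 : R), S (c t) & is_derive (0 : R) 1 c v]].

Definition is_inward_normal Omega x v : Prop :=
  [/\ enorm v = 1,
      forall w, tangent_space (boundary Omega) x w -> dot v w = 0 &
      \forall t \near (0 : R)^'+, Omega (x + t *: v)].

Definition inward_normal Omega x : E := xget 0 (is_inward_normal Omega x).

Definition C1_on S (b : E -> R) : Prop :=
  forall x, S x -> exists2 b' : E -> R, C1 b' &
    \forall y \near x, S y -> b y = b' y.

(* A plane is identified with the orthogonal projection onto it, a symmetric
   idempotent matrix acting on row vectors by right multiplication; it is then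
   the row space of that matrix. *)
Definition grassmannian (m : nat) : set M :=
  [set P | [/\ P^T = P, P *m P = P & \rank P = m]].

End geometry.

Section varifolds.
Context {R : realType} {n : nat}.
Local Notation E := 'rV[R]_n.+1.
Local Notation M := 'M[R]_n.+1.
Local Notation hausdorff_measure := (@hausdorff_measure R n.+1).

(* Borel measures on these Polish locally compact spaces that are finite on
   compact sets are automatically regular. *)
Definition radon (T : ptopologicalType)
    (mu : {measure set (borel T) -> \bar R}) : Prop :=
  forall K : set T, compact K -> (mu K < +oo)%E.

(* Radon measures on a closed subset A of T are the Radon measures on T
   concentrated on A. *)
Definition concentrated_on (T : ptopologicalType)
    (mu : {measure set (borel T) -> \bar R}) (A : set T) : Prop :=
  mu.-negligible (~` A : set (borel T)).

Lemma measurable_borel_fst :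
  measurable_fun [set: borel (E * M)%type] (fst : borel (E * M)%type -> borel E).
Proof.
apply: (measurability _ (erefl : @measurable _ (borel E) = <<s @open E>>)) => // _ [B oB <-].
rewrite setTI; apply: sub_sigma_algebra.
by apply: open_comp => // x _; exact: cvg_fst.
Qed.

Implicit Types (Omega : set E) (V : {measure set (borel (E * M)%type) -> \bar R}).

Definition grass_bundle Omega (m : nat) : set (E * M) :=
  closure Omega `*` grassmannian m.

Definition varifold Omega (m : nat) V : Prop :=
  radon V /\ concentrated_on V (grass_bundle Omega m).

Definition weight V : set (borel E) -> \bar R :=
  pushforward V (fst : borel (E * M)%type -> borel E).

Let weight0 V : weight V set0 = 0%E.
Proof. by rewrite /weight /pushforward preimage_set0 measure0. Qed.

Let weight_ge0 V (A : set (borel E)) : (0 <= weight V A)%E.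
Proof. by rewrite /weight /pushforward measure_ge0. Qed.

Let weight_sigma_additive V : semi_sigma_additive (weight V).
Proof.
move=> F mF tF mUF; rewrite /weight /pushforward preimage_bigcup.
have mfst (B : set (borel E)) : measurable B ->
    measurable (fst @^-1` B : set (borel (E * M)%type)).
  by move=> mB; rewrite -[X in measurable X]setTI; exact: measurable_borel_fst.
apply: measure_semi_sigma_additive.
- by move=> k; exact: mfst.
- apply/trivIsetP => /= i j _ _ ij; rewrite -preimage_setI.
  by move/trivIsetP : tF => /(_ _ _ _ _ ij) ->//; rewrite preimage_set0.
- by rewrite -preimage_bigcup; exact: mfst.
Qed.

HB.instance Definition _ V := isMeasure.Build _ _ _ (weight V)
  (weight0 V) (weight_ge0 V) (@weight_sigma_additive V).

(* div_P phi = tr (P D phi), where L is the differential of phi. *)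
Definition divergence (P : M) (L : E -> E) : R := \tr (P *m lin1_mx L).

Definition first_variation Omega (m : nat) V (dphi : E -> E -> E) : R :=
  \int[V]_(z in grass_bundle Omega m) divergence z.2 (dphi z.1).

Definition C1_tangential Omega (phi : E -> E) (dphi : E -> E -> E) : Prop :=
  C1_closure Omega phi dphi /\
  forall x, boundary Omega x -> tangent_space (boundary Omega) x (phi x).

Definition compactly_supported Omega (phi : E -> E) : Prop :=
  compact (closure [set x | closure Omega x /\ phi x <> 0]).

Definition capillary_bundle Omega (beta : E -> R) (m : nat) : set (E * M) :=
  [set z | let: (x, P) := z in let nuP := inward_normal Omega x *m P in
     [/\ boundary Omega x, grassmannian m P, enorm nuP = sin (beta x) &
         forall w, (w <= P)%MS -> tangent_space (boundary Omega) x w ->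
           dot w nuP = 0]].

Definition conormal Omega (x : E) (P : M) : E :=
  (enorm (inward_normal Omega x *m P))^-1 *: (inward_normal Omega x *m P).

Definition capillary_varifold Omega (beta : E -> R) (m : nat) V (H : E -> E) :
    Prop :=
  [/\ varifold Omega m V,
      measurable_fun (closure Omega : set (borel E)) (H : borel E -> borel E),
      forall K : set E, compact K ->
        (weight V).-integrable (K `&` closure Omega)
          (fun x => (enorm (H x))%:E),
      {ae weight V, forall x, boundary Omega x ->
        tangent_space (boundary Omega) x (H x)} &
      exists Gamma : {measure set (borel (E * M)%type) -> \bar R},
        [/\ radon Gamma, concentrated_on Gamma (capillary_bundle Omega beta m) &
            forall phi dphi, C1_tangential Omega phi dphi ->
              compactly_supported Omega phi ->
              first_variation Omega m V dphi =
              - (\int[weight V]_(x in closure Omega) dot (H x) (phi x))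
              - \int[Gamma]_(z in capillary_bundle Omega beta m)
                  dot (conormal Omega z.1 z.2) (phi z.1)]].

Definition rectifiable_set (m : nat) (S : set E) : Prop :=
  measurable (S : set (caratheodory_type (hausdorff_outer n.+1 m))) /\
  exists (S0 : set E) (F : nat -> 'rV[R]_m -> E),
    [/\ hausdorff m S0 = 0%E,
        forall j, exists L : R,
          forall u v, enorm (F j u - F j v) <= L * enorm (u - v) &
        S `<=` S0 `|` \bigcup_j range (F j)].

(* P is the approximate tangent space at x of S with multiplicity theta:
   the blow-ups of theta H^m restricted to S converge to theta(x) H^m
   restricted to P, as functionals on continuous functions of compact support. *)
Definition approx_tangent (m : nat) (S : set E) (theta : E -> R) (x : E)
    (P : M) : Prop :=
  forall f : E -> R, continuous f ->
    (exists2 K : set E, compact K & forall y, ~ K y -> f y = 0) ->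
    lambda ^- m *
      (\int[hausdorff_measure m]_(y in S) (f (lambda^-1 *: (y - x)) * theta y))
      @[lambda --> (0 : R)^'+] -->
    theta x * \int[hausdorff_measure m]_(y in [set y : E | (y <= P)%MS]) f y.

(* V = theta H^m restricted to S, tensored with the Dirac masses at T x, where
   T x is the approximate tangent space at almost every x of S. As T matters
   only up to null sets, it is taken Borel measurable. *)
Definition rectifiable_varifold Omega (m : nat) V (S : set E) (theta : E -> R)
    (T : E -> M) : Prop :=
  [/\ rectifiable_set m S /\ S `<=` closure Omega,
      (forall x, S x -> 0 < theta x) /\
      (forall K : set E, compact K ->
        (hausdorff_measure m).-integrable (S `&` K) (EFin \o theta)),
      measurable_fun [set: borel E] (T : borel E -> borel M),
      hausdorff m [set x | S x /\
        ~ (grassmannian m (T x) /\ approx_tangent m S theta x (T x))] = 0%E &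
      forall A : set (borel (E * M)%type), measurable A ->
        V A = (\int[hausdorff_measure m]_(x in S `&` [set x | A (x, T x)])
                 (theta x)%:E)%E].

Definition gradient (L : E -> R) : E := \row_i L (delta_mx 0 i).

End varifolds.

(* Main.v *)
(* The first variation is tested on h(x) g(|x - xi|) (x - xi), where g is a C^1
   approximation of r |-> (max(r, r1)^-m - r2^-m)_+ / m. The field vanishes on
   the boundary, so the boundary varifold does not contribute. As
   g'(r) = - r^-(m+1) on (r1, r2], the divergence along a plane P yields in the
   limit
     r1^-m 1_{r <= r1} - r2^-m 1_{r <= r2} + 1_{r1 < r <= r2} |(x - xi)^perp|^2 / r^(m+2)
   times h, which gives the integrated inequality directly, without
   differentiating the mass in the radius. The remaining term
   g(r) r (h |H| + |grad^V h|) is compared with the error term by Tonelli,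
   since g(r) r <= int_{r1}^{r2} 1_{r <= t} t^-m dt. *)

Require Import Defs.
From HB Require Import structures.
From mathcomp Require Import all_boot all_order all_algebra.
From mathcomp Require Import all_classical all_reals all_analysis.
From mathcomp Require Import measurable_realfun ring lra.

Set Implicit Arguments.
Unset Strict Implicit.
Unset Printing Implicit Defensive.

Import Order.TTheory GRing.Theory Num.Theory.
Import numFieldNormedType.Exports.

Local Open Scope classical_set_scope.
Local Open Scope ring_scope.

(** * Euclidean inner product and orthogonal projections *)

Section euclidean_geometry.
Context {R : realType} {N : nat}.
Implicit Types (u v w : 'rV[R]_N) (P : 'M[R]_N).

(** The cutoff is smoothed in the variable u = r^-m rather than in r: it becomes a difference of two
    ramps with thresholds a = r2^-m and b = r1^-m, and differentiating r^-m supplies the radial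
    weight. The smoothing is one-sided because the weight measure may charge the spheres of radius
    r1 and r2, while the limit has to select exactly r1 < r <= r2, the difference of two closed
    balls. The price is that the smoothed cutoff reaches slightly beyond r2; when h does not vanish
    on the boundary, the strict inequality r2 < d_S(xi) leaves room for this once d is small.
    Boundedness of the domain makes its closure compact, so the weight measure is finite, |H| is
    integrable there, and one majorant serves all d. The plane field T is a field of orthogonal
    projections only almost everywhere; pointwise estimates therefore use a corrected field, and T
    itself returns only in the final integrals. *)

Lemma dotE u v : dot u v = \sum_i u 0 i * v 0 i.
Proof. by rewrite /dot mxE; apply: eq_bigr => i _; rewrite mxE. Qed.

Lemma dotC u v : dot u v = dot v u.
Proof. by rewrite !dotE; apply: eq_bigr => i _; rewrite mulrC. Qed.

Lemma dotDl u v w : dot (u + v) w = dot u w + dot v w.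
Proof. by rewrite /dot mulmxDl mxE. Qed.

Lemma dotDr u v w : dot w (u + v) = dot w u + dot w v.
Proof. by rewrite dotC dotDl !(dotC _ w). Qed.

Lemma dotZl a u v : dot (a *: u) v = a * dot u v.
Proof. by rewrite /dot -scalemxAl mxE. Qed.

Lemma dotZr a u v : dot u (a *: v) = a * dot u v.
Proof. by rewrite dotC dotZl dotC. Qed.

Lemma dotNl u v : dot (- u) v = - dot u v.
Proof. by rewrite -scaleN1r dotZl mulN1r. Qed.

Lemma dot0l v : dot 0 v = 0.
Proof. by rewrite /dot mul0mx mxE. Qed.

Lemma dot0r v : dot v 0 = 0.
Proof. by rewrite dotC dot0l. Qed.

Lemma dot_ge0 u : 0 <= dot u u.
Proof. by rewrite dotE sumr_ge0// => i _; rewrite -expr2 sqr_ge0. Qed.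

Lemma enorm_ge0 u : 0 <= enorm u.
Proof. exact: sqrtr_ge0. Qed.

Lemma enorm_sqr u : enorm u ^+ 2 = dot u u.
Proof. by rewrite sqr_sqrtr ?dot_ge0. Qed.

Lemma enormN u : enorm (- u) = enorm u.
Proof. by rewrite /enorm dotNl dotC dotNl opprK. Qed.

Lemma enorm0_eq0 u : enorm u = 0 -> u = 0.
Proof.
move=> u0; have : dot u u = 0 by rewrite -enorm_sqr u0 expr0n.
rewrite dotE => /eqP; rewrite psumr_eq0 => [/allP H|i _]; last first.
  by rewrite -expr2 sqr_ge0.
apply/rowP => i; rewrite mxE; apply/eqP.
by have := H i (mem_index_enum _); rewrite -expr2 sqrf_eq0.
Qed.

Lemma dot_le_enorm u v : dot u v <= enorm u * enorm v.
Proof.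
(* Expands |a u - b v|^2 >= 0. The choice a = |v|, b = |u| and division by |u| |v| give
   Cauchy-Schwarz, which is why zero vectors are treated apart. *)
have H (a b : R) : dot u v *+ 2 * (a * b) <= a ^+ 2 * enorm u ^+ 2 + b ^+ 2 * enorm v ^+ 2.
  have := dot_ge0 (a *: u + (- b) *: v).
  rewrite !(dotDl, dotDr, dotZl, dotZr) (dotC v u) !enorm_sqr => h.
  rewrite -subr_ge0; apply: le_trans h _; rewrite le_eqVlt; apply/orP; left.
  by apply/eqP; ring.
have := H (enorm v) (enorm u).
have [/enorm0_eq0->|u0] := eqVneq (enorm u) 0.
  by rewrite dot0l mulr_ge0 ?enorm_ge0.
have [/enorm0_eq0->|v0] := eqVneq (enorm v) 0.
  by rewrite dot0r mulr_ge0 ?enorm_ge0.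
have pos : 0 < enorm v * enorm u by rewrite mulr_gt0// lt_neqAle eq_sym ?u0 ?v0 enorm_ge0.
move=> K; rewrite -(ler_pM2r pos); move: K; set x := dot u v; nra.
Qed.

Lemma normr_dot_le u v : `|dot u v| <= enorm u * enorm v.
Proof.
rewrite ler_norml dot_le_enorm andbT lerNl -dotNl.
by rewrite (le_trans (dot_le_enorm _ _))// enormN.
Qed.

Section orthogonal_projection.
Variable P : 'M[R]_N.
Hypotheses (symP : P^T = P) (idemP : P *m P = P).

Lemma dot_proj u v : dot (u *m P) v = dot u (v *m P).
Proof. by rewrite /dot trmx_mul symP mulmxA. Qed.

Lemma enorm_proj_sqr u : enorm (u *m P) ^+ 2 = dot u (u *m P).
Proof. by rewrite enorm_sqr dot_proj -mulmxA idemP. Qed.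

Lemma enorm_coproj_sqr u :
  enorm (u - u *m P) ^+ 2 = enorm u ^+ 2 - enorm (u *m P) ^+ 2.
Proof.
rewrite enorm_proj_sqr !enorm_sqr !(dotDl, dotDr, dotNl) (dotC u (- _)).
by rewrite (dotC (_ *m _) (- _)) !dotNl -[dot (u *m P) (u *m P)]enorm_sqr
  enorm_proj_sqr (dotC (_ *m P)); ring.
Qed.

Lemma enorm_proj_le u : enorm (u *m P) <= enorm u.
Proof.
rewrite -(@ler_pXn2r _ 2)// ?nnegrE ?enorm_ge0//.
by rewrite -subr_ge0 -enorm_coproj_sqr sqr_ge0.
Qed.

End orthogonal_projection.

(** In a rank factorisation P = C B, the factors have one-sided inverses; cancelling them in C B C B
    = C B leaves B C = 1, so tr P = tr (B C) is the size of that identity. *)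
Lemma mxtrace_idem (F : fieldType) n (P : 'M[F]_n) :
  P *m P = P -> \tr P = (\rank P)%:R.
Proof.
have := mulmx_base P; move: (col_base P) (row_base P)
  (col_base_full P) (row_base_free P) => C B /row_fullP[C' CC] /row_freeP[B' BB].
move=> PE idem; rewrite -{1}PE mxtrace_mulC.
suff -> : B *m C = 1%:M by rewrite mxtrace1.
have : C' *m (C *m B *m (C *m B)) *m B' = C' *m (C *m B) *m B' by rewrite PE idem.
by rewrite !mulmxA CC !mul1mx -!mulmxA BB mulmx1.
Qed.

End euclidean_geometry.

(** * One-sided C^1 cutoffs and the radial profile *)

Section radial_cutoff.
Context {R : realType}.
Implicit Types (s t u d a b : R).

(** A quadratic remainder identifies the derivative at every point at once, which avoids separate
    treatment of the kinks of a squared positive part. *)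
Lemma is_derive_quad (f : R -> R) (s l C : R) :
  (forall e, `|f (s + e) - f s - e * l| <= C * e ^+ 2) -> is_derive s 1 f l.
Proof.
move=> fC.
have lim : (fun e : R => e^-1 *: (f (e *: 1 + s) - f s)) @ 0^' --> l.
  apply/cvgrPdist_le => eps eps0.
  have C0 : 0 < `|C| + 1 by rewrite ltr_wpDl.
  near=> e.
  have e0 : e != 0 by near: e; exact: nbhs_dnbhs_neq.
  have -> : l - e^-1 *: (f (e *: 1 + s) - f s) =
      - (e^-1 * (f (s + e) - f s - e * l)).
    rewrite /GRing.scale/= mulr1 (addrC e s); field; exact: e0.
  rewrite normrN normrM normfV ler_pdivrMl ?normr_gt0//.
  apply: le_trans (fC e) _; rewrite -real_normK ?num_real// expr2 mulrCA.
  rewrite ler_wpM2l// (@le_trans _ _ ((`|C| + 1) * `|e|))//.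
    by rewrite ler_wpM2r// (le_trans (ler_norm C))// lerDl.
  rewrite -ler_pdivlMl// mulrC; apply: ltW; near: e.
  have : \forall e \near (0 : R), `|e| < eps / (`|C| + 1).
    have e1 : 0 < eps / (`|C| + 1) by rewrite divr_gt0.
    near=> z; have : `|0 - z| < eps / (`|C| + 1); last by rewrite sub0r normrN.
    by near: z; exact: nbhsx_ballx.
  exact: nbhs_dnbhs.
apply: DeriveDef; first by apply/cvg_ex; exists l.
exact: cvg_lim.
Unshelve. all: by end_near. Qed.

(* A C^1 approximation, at distance at most [d], of the positive part of [s]
   with derivative [dramp]; it is exactly affine of slope 1 for [s >= 0] and
   vanishes for [s <= - d], so that the cutoffs below select the half-open
   annulus r1 < r <= r2 in the limit. *)
Definition ramp d s := ((Num.max (s + d) 0) ^+ 2 - (Num.max s 0) ^+ 2) / (2 * d).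
Definition dramp d s := (Num.max (s + d) 0 - Num.max s 0) / d.

Lemma is_derive_ramp d s : 0 < d -> is_derive s 1 (ramp d) (dramp d s).
Proof.
move=> d0; apply: (@is_derive_quad _ _ _ d^-1) => e.
have -> : ramp d (s + e) - ramp d s - e * dramp d s =
  ((Num.max (s + d + e) 0 ^+ 2 - Num.max (s + d) 0 ^+ 2 - 2 * e * Num.max (s + d) 0) -
   (Num.max (s + e) 0 ^+ 2 - Num.max s 0 ^+ 2 - 2 * e * Num.max s 0)) / 2 / d.
  rewrite /ramp /dramp (addrAC s e d); field; exact: lt0r_neq0.
(* The squared positive part has the 2-Lipschitz derivative 2 max(x, 0), hence a Taylor remainder of
   at most e^2. The two remainders in [ramp] add up to 2 e^2, and division by 2 d leaves the
   constant 1 / d. *)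
have H (x : R) : `|Num.max (x + e) 0 ^+ 2 - Num.max x 0 ^+ 2 - 2 * e * Num.max x 0|
    <= e ^+ 2.
  rewrite ler_norml; case: (lerP (x + e) 0) => xe; case: (lerP x 0) => x0;
    by apply/andP; split; nra.
rewrite normrM normfV (gtr0_norm d0) mulrC ler_pM2l ?invr_gt0//.
rewrite normrM normfV normr_nat ler_pdivrMr//.
by rewrite (le_trans (ler_normB _ _))// mulrDr !mulr1 lerD.
Qed.

Lemma ramp_le d s : 0 < d -> Num.max s 0 <= ramp d s <= Num.max s 0 + d.
Proof.
move=> d0; rewrite /ramp ler_pdivlMr ?ler_pdivrMr ?mulr_gt0//.
by case: (lerP (s + d) 0) => sd; case: (lerP s 0) => s0; apply/andP; split; nra.
Qed.

Lemma ramp_homo d s t : 0 < d -> s <= t -> ramp d s <= ramp d t.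
Proof.
move=> d0 st; rewrite /ramp ler_pM2r ?invr_gt0 ?mulr_gt0//.
case: (lerP (s + d) 0) => sd; case: (lerP s 0) => s0;
case: (lerP (t + d) 0) => td; case: (lerP t 0) => t0; nra.
Qed.

Lemma ramp_ge0E d s : 0 < d -> 0 <= s -> ramp d s = s + d / 2.
Proof.
move=> d0 s0; rewrite /ramp !max_l ?addr_ge0// ?(ltW d0)//.
field; exact: lt0r_neq0.
Qed.

Lemma dramp_ge0E d s : 0 < d -> 0 <= s -> dramp d s = 1.
Proof.
move=> d0 s0; rewrite /dramp !max_l ?addr_ge0// ?(ltW d0)//.
field; exact: lt0r_neq0.
Qed.

Lemma ramp_le0E d s : 0 < d -> s + d <= 0 -> ramp d s = 0.
Proof.
move=> d0 sd; rewrite /ramp !max_r ?subrr ?mul0r//.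
by rewrite (le_trans _ sd)// lerDl ltW.
Qed.

Lemma dramp_le0E d s : 0 < d -> s + d <= 0 -> dramp d s = 0.
Proof.
move=> d0 sd; rewrite /dramp !max_r ?subrr ?mul0r//.
by rewrite (le_trans _ sd)// lerDl ltW.
Qed.

Lemma dramp_01 d s : 0 < d -> 0 <= dramp d s <= 1.
Proof.
move=> d0; rewrite /dramp ler_pdivlMr ?ler_pdivrMr//.
by case: (lerP (s + d) 0) => sd; case: (lerP s 0) => s0; apply/andP; split; nra.
Qed.

Lemma continuous_dramp d : continuous (dramp d).
Proof.
move=> s; apply: cvgM; last exact: cvg_cst.
have H (f : R -> R) : continuous f -> continuous (fun s => Num.max (f s) 0).
  by move=> cf x; apply: (@continuous_max _ _ f (cst 0) x); [exact: cf|exact: cst_continuous].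
apply: cvgB; first by apply: (H (fun s => s + d)) => x; apply: cvgD; [exact: cvg_id|exact: cvg_cst].
by apply: (H id) => x; exact: cvg_id.
Qed.

(** For a <= b, a smoothing of min(max(u - a, 0), b - a): it is constant equal to b - a for u >= b,
    and zero for u <= a - d. *)
Definition cut d a b u := ramp d (u - a) - ramp d (u - b).
Definition dcut d a b u := dramp d (u - a) - dramp d (u - b).

Lemma is_derive_cut d a b u : 0 < d -> is_derive u 1 (cut d a b) (dcut d a b u).
Proof.
move=> d0; have H c : is_derive u 1 (fun u => ramp d (u - c)) (dramp d (u - c)).
  have := @is_derive1_comp _ (ramp d) (fun u => u - c) u (dramp d (u - c)) 1.
  rewrite mulr1; apply.
    exact: is_derive_ramp.
  by rewrite -[X in is_derive _ _ _ X]subr0; exact: is_deriveB.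
exact: is_deriveB.
Qed.

Lemma continuous_dcut d a b : continuous (dcut d a b).
Proof.
move=> u; have H c : {for u, continuous (fun u => dramp d (u - c))}.
  apply: (@continuous_comp _ _ _ (fun u => u - c) (dramp d)).
    by apply: cvgB; [exact: cvg_id|exact: cvg_cst].
  exact: continuous_dramp.
by apply: cvgB; exact: H.
Qed.

Lemma continuous_cut d a b : 0 < d -> continuous (cut d a b).
Proof.
move=> d0 u; apply: differentiable_continuous; apply/derivable1_diffP.
exact: (@ex_derive _ _ _ _ _ _ _ (is_derive_cut a b u d0)).
Qed.

Definition clamp a b u := Num.max (u - a) 0 - Num.max (u - b) 0.

(** Each ramp exceeds its positive part by an amount in [0, d], so the errors of the two ramps
    differ by at most d, uniformly in u. *)
Lemma cut_clamp d a b u : 0 < d -> `|cut d a b u - clamp a b u| <= d.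
Proof.
move=> d0; have /andP[h1 h2] := ramp_le (u - a) d0.
have /andP[h3 h4] := ramp_le (u - b) d0.
by rewrite ler_norml /cut /clamp; apply/andP; split; lra.
Qed.

Lemma dcut_norm_le1 d a b u : 0 < d -> `|dcut d a b u| <= 1.
Proof.
move=> d0; have /andP[h1 h2] := dramp_01 (u - a) d0.
have /andP[h3 h4] := dramp_01 (u - b) d0.
by rewrite ler_norml /dcut; apply/andP; split; lra.
Qed.

Lemma dcut_right d a b u : 0 < d -> a <= b -> b <= u -> dcut d a b u = 0.
Proof. by move=> d0 ab bu; rewrite /dcut !dramp_ge0E ?subrr//; lra. Qed.

Lemma dcut_mid d a b u : 0 < d -> a <= u -> u + d <= b -> dcut d a b u = 1.
Proof.
move=> d0 au ub; rewrite /dcut dramp_ge0E// ?dramp_le0E ?subr0//; lra.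
Qed.

Lemma dcut_left d a b u : 0 < d -> a <= b -> u + d <= a -> dcut d a b u = 0.
Proof. by move=> d0 ab ua; rewrite /dcut !dramp_le0E ?subrr//; lra. Qed.

Lemma cut_left d a b u : 0 < d -> a <= b -> u + d <= a -> cut d a b u = 0.
Proof. by move=> d0 ab ua; rewrite /cut !ramp_le0E ?subrr//; lra. Qed.

Section profile.
Variables (m : nat) (r a d : R).
Hypotheses (r0 : 0 < r) (d0 : 0 < d).

(* The radius is truncated at [r], where the cutoff is constant, so that the
   profile is smooth at the centre. *)
Definition trunc_radius t := Num.max (Num.sqrt t) r.

Definition profile t := cut d a (r ^- m) (trunc_radius t ^- m).
Definition dprofile t := - (m%:R / 2) * (dcut d a (r ^- m) (trunc_radius t ^- m)
   * trunc_radius t ^- (m + 2)).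

Lemma trunc_radius_gt0 t : 0 < trunc_radius t.
Proof. by rewrite lt_max r0 orbT. Qed.

Lemma continuous_trunc_radius_exp k : continuous (fun t => trunc_radius t ^- k).
Proof.
move=> t; apply: cvgV; first by rewrite expf_neq0// gt_eqF// trunc_radius_gt0.
apply: (@continuous_comp _ _ _ trunc_radius (fun x => x ^+ k)).
  apply: (@continuous_max _ _ Num.sqrt (cst r)).
    exact: sqrt_continuous.
  exact: cst_continuous.
exact: exprn_continuous.
Qed.

Lemma continuous_dprofile : continuous dprofile.
Proof.
move=> t; apply: cvgM; first exact: cvg_cst.
apply: cvgM; last exact: continuous_trunc_radius_exp.
apply: (@continuous_comp _ _ _ (fun t => trunc_radius t ^- m)).
  exact: continuous_trunc_radius_exp.
exact: continuous_dcut.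
Qed.

Lemma is_derive_profile t : a <= r ^- m -> is_derive t 1 profile (dprofile t).
Proof.
have sqrt_le s : s <= r ^+ 2 -> Num.sqrt s <= r.
  by move=> sr; rewrite -[leRHS](ger0_norm (ltW r0)) -sqrtr_sqr ler_wsqrtr.
move=> ar; have [tr|rt] := ltP t (r ^+ 2).
  have E : \forall s \near t, cst (cut d a (r ^- m) (r ^- m)) s = profile s.
    near=> s; have sr : s < r ^+ 2 by near: s; exact: lt_nbhsl.
    rewrite /profile /trunc_radius max_r//.
    exact/sqrt_le/ltW.
  have -> : dprofile t = 0.
    rewrite /dprofile dcut_right ?mul0r ?mulr0//.
    by rewrite /trunc_radius max_r//; exact/sqrt_le/ltW.
  by apply: near_eq_is_derive E _.
have t0 : 0 < t by rewrite (lt_le_trans _ rt)// exprn_gt0.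
pose f s := cut d a (r ^- m) (Num.sqrt s ^- m).
have st0 : 0 < Num.sqrt t by rewrite sqrtr_gt0.
have E : \forall s \near t, f s = profile s.
  near=> s; have s0 : 0 < s by near: s; exact: lt_nbhsr.
  rewrite /f /profile /trunc_radius; case: (leP (Num.sqrt s) r) => sr//.
  (* Inside radius r, the truncated and untruncated arguments are both at least [r ^- m], where both
     ramps are affine of slope 1 and their difference is constant. Hence the truncation creates no
     kink at radius r. *)
  have vr : r ^- m <= Num.sqrt s ^- m.
    by rewrite lef_pV2 ?posrE ?exprn_gt0 ?sqrtr_gt0// lerXn2r ?nnegrE ?sqrtr_ge0// ltW.
  by rewrite /cut !ramp_ge0E ?subr_ge0// ?(le_trans ar)//; lra.
have tE : trunc_radius t = Num.sqrt t.
  rewrite /trunc_radius max_l// -[leLHS](ger0_norm (ltW r0)) -sqrtr_sqr.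
  by rewrite ler_wsqrtr.
apply: near_eq_is_derive E _.
(* For s > 0 this is the real power s^(-m/2); the exponent -m/2 - 1 of its derivative is read as -(m
   + 2)/2. *)
have D1 : is_derive t 1 (fun s => Num.sqrt s ^- m)
    (- (m%:R / 2) * Num.sqrt t ^- (m + 2)).
  have D := @is_derive1_powR R (- (m%:R / 2)) t t0.
  have E1 : \forall s \near t, (s `^ (- (m%:R / 2)) = Num.sqrt s ^- m).
    near=> s; have s0 : 0 < s by near: s; exact: lt_nbhsr.
    by rewrite powRN mulrC powRrM powR12_sqrt ?(ltW s0)// powR_mulrn ?sqrtr_ge0.
  apply: near_eq_is_derive E1 _.
  apply: is_derive_eq D _; congr (_ * _).
  rewrite -opprD -[X in _ + X](@divff _ 2%:R)// -mulrDl powRN mulrC powRrM.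
  by rewrite powR12_sqrt ?(ltW t0)// -natrD powR_mulrn ?sqrtr_ge0.
rewrite /dprofile tE.
have := @is_derive1_comp _ (cut d a (r ^- m)) (fun s => Num.sqrt s ^- m) t _ _
  (is_derive_cut a (r ^- m) _ d0) D1.
by move=> D; apply: is_derive_eq D _; rewrite mulrCA.
Unshelve. all: by end_near. Qed.

End profile.
End radial_cutoff.

(** * Product rule for a scalar function times a vector function *)

Section scaling.
Context {R : realType} {V : normedModType R}.

(** A name for scaling, so that it can carry the bilinear structure from which the product rule
    follows. *)
Definition scalev (a : R) (v : V) : V := a *: v.

Lemma scalev_is_bilinear :
  bilinear_for (GRing.Scale.Law.clone _ _ *:%R _) (GRing.Scale.Law.clone _ _ *:%R _)
    scalev.
Proof.
rewrite /scalev; split=> [v|a] b x y /=.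
- by rewrite scalerDl scalerA.
- by rewrite scalerDr !scalerA mulrC.
Qed.

HB.instance Definition _ := bilinear_isBilinear.Build R R V V _ _
  scalev scalev_is_bilinear.

Lemma is_diff_scale (U : normedModType R) (f df : U -> R) (g dg : U -> V) x :
  is_diff x f df -> is_diff x g dg ->
  is_diff x (fun y => f y *: g y) (fun v => df v *: g x + f x *: dg v).
Proof.
move=> dfx dgx.
pose b (p : R * V) := p.1 *: p.2.
have cb : continuous b.
  by move=> p; apply: cvgZ; [exact: cvg_fst|exact: cvg_snd].
have db p : is_diff p b (fun q => p.1 *: q.2 + q.1 *: p.2).
  apply: DiffDef.
    exact: (@differentiable_bilin _ _ _ _ scalev).
  exact: (@diff_bilin _ _ _ _ scalev).
have := @is_diff_comp _ _ _ _ _ _ _ _ x (is_diff_pair dfx dgx) (db (f x, g x)).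
by move=> D; apply: is_diff_eq D _; apply/funext => v /=; rewrite addrC.
Qed.

End scaling.

(** * The radial test field and its divergence *)

Section radial_field.
Context {R : realType} {n : nat}.
Local Notation E := 'rV[R]_n.+1.
Implicit Types (v xi : E) (h : E -> R).

Lemma continuous_dot (U : topologicalType) (f g : U -> E) x :
  {for x, continuous f} -> {for x, continuous g} ->
  {for x, continuous (fun y => dot (f y) (g y))}.
Proof.
move=> cf cg; have coord (k : U -> E) i : {for x, continuous k} ->
    {for x, continuous (fun y => k y 0 i)}.
  move=> ck; apply: (@continuous_comp _ _ _ k (fun u : E => u 0 i)) => //.
  exact: coord_continuous.
rewrite (_ : (fun y => _) = \sum_i (fun y => f y 0 i * g y 0 i)); last first.
  by apply/funext => y; rewrite fct_sumE dotE.
elim/big_ind : _ => [|k l ck cl|i _]; first exact: cst_continuous.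
  exact: cvgD.
by apply: cvgM; exact: coord.
Qed.

Lemma is_diff_sqdist xi (x : E) :
  is_diff x (fun y : E => dot (y - xi) (y - xi)) (fun v => 2 * dot (x - xi) v).
Proof.
have ->: (fun y : E => dot (y - xi) (y - xi)) =
   \sum_(i < n.+1) (fun y : E => (y 0 i - xi 0 i) * (y 0 i - xi 0 i)).
  apply/funext => y; rewrite fct_sumE dotE; apply: eq_bigr => i _.
  by rewrite !mxE.
have D (i : 'I_n.+1) : is_diff x (fun y : E => (y 0 i - xi 0 i) * (y 0 i - xi 0 i))
    (fun v => 2 * ((x - xi) 0 i * v 0 i)).
  have D0 : is_diff x (fun y : E => y 0 i) (fun v => v 0 i).
    apply: DiffDef; first exact: differentiable_coord.
    have @f : {linear E -> R}.
      by exists (fun N : E => N 0 i); do 2![eexists]; do ?[constructor];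
        rewrite ?mxE// => ? *; rewrite ?mxE//; move=> ?; rewrite !mxE.
    rewrite (_ : (fun _ => _) = f)// diff_lin//; exact: coord_continuous.
  have D1 : is_diff x (fun y : E => y 0 i - xi 0 i) (fun v => v 0 i).
    have := is_diffB D0 (is_diff_cst (xi 0 i) x).
    by move=> D1; apply: is_diff_eq D1 _; apply/funext => v; rewrite -[RHS]subr0.
  have := is_diffM D1 D1; move=> D2; apply: is_diff_eq D2 _; apply/funext => v.
  by rewrite !mxE -[LHS]/((x 0 i - xi 0 i) * v 0 i + (x 0 i - xi 0 i) * v 0 i); ring.
have : is_diff x (\sum_(i < n.+1) (fun y : E => (y 0 i - xi 0 i) * (y 0 i - xi 0 i)))
  (\sum_(i < n.+1) (fun v => 2 * ((x - xi) 0 i * v 0 i))).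
  by elim/big_ind2 : _ => [|f f' g g' df dg|i _];
    [exact: is_diff_cst|exact: is_diffD|exact: D].
move=> D'; apply: is_diff_eq D' _; apply/funext => v.
by rewrite fct_sumE dotE mulr_sumr.
Qed.

(** [g] takes the squared distance, a polynomial, so that no square root spoils differentiability at
    [xi]. *)
Definition radial_field xi h (g : R -> R) (x : E) : E :=
  (h x * g (dot (x - xi) (x - xi))) *: (x - xi).

(** The product rule written with [dh], the extension of the derivative to the closure, because h
    need not be differentiable at boundary points. *)
Definition dradial_field xi h (dh : E -> E -> R) (g g' : R -> R) (x v : E) : E :=
  (dh x v * g (dot (x - xi) (x - xi)) +
    h x * (2 * g' (dot (x - xi) (x - xi)) * dot (x - xi) v)) *: (x - xi) +
  (h x * g (dot (x - xi) (x - xi))) *: v.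

Lemma C1_radial_field (Omega : set E) xi h dh (g g' : R -> R) :
  C1_closure Omega h dh -> (forall t : R, is_derive t 1 g (g' t)) ->
  continuous g' ->
  C1_closure Omega (radial_field xi h g) (dradial_field xi h dh g g').
Proof.
move=> [ch dhE cdh] gg' cg'.
have cg : continuous g.
  move=> t; apply: differentiable_continuous; apply/derivable1_diffP.
  exact: (@ex_derive _ _ _ _ _ _ _ (gg' t)).
have csub : continuous (fun x : E => x - xi).
  by move=> x; apply: continuousB; [exact: (fun A => id)|exact: cst_continuous].
pose q (x : E) := dot (x - xi) (x - xi).
have ck (k : R -> R) : continuous k -> {within closure Omega, continuous (k \o q)}.
  move=> ck; apply: continuous_subspaceT => x.
  apply: continuous_comp; last exact: ck.
  by apply: continuous_dot; exact: csub.
have cid : {within closure Omega, continuous (fun x : E => x - xi)}.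
  exact: continuous_subspaceT.
have cdot v : {within closure Omega, continuous (fun x : E => dot (x - xi) v)}.
  apply: continuous_subspaceT => x.
  exact: (@continuous_dot _ (fun y : E => y - xi) (cst v) x (csub x) (@cst_continuous _ _ v x)).
split => [x|x Ox|v x].
- by apply: cvgZ; [apply: cvgM; [exact: ch|exact: ck]|exact: cid].
- have Dk : is_diff x (g \o q) (fun v => 2 * g' (q x) * dot (x - xi) v).
    have Dg : is_diff (q x) g (fun e => e * g' (q x)).
      have dg := @ex_derive _ _ _ _ _ _ _ (gg' (q x)).
      apply: DiffDef; first exact/derivable1_diffP.
      rewrite diff1E; last exact/derivable1_diffP.
      by apply/funext => e; rewrite derive1E (@derive_val _ _ _ _ _ _ _ (gg' _)).
    have D := @is_diff_comp _ _ _ _ _ _ _ _ _ (is_diff_sqdist xi x) Dg.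
    by apply: is_diff_eq D _; apply/funext => v /=; ring.
  have Dhk := is_diffM (dhE _ Ox) Dk.
  have Did : is_diff x (fun y : E => y - xi) id.
    have D := is_diffB (is_diff_id x) (is_diff_cst xi x).
    by apply: is_diff_eq D _; apply/funext => v; rewrite -[RHS]subr0.
  have D := is_diff_scale Dhk Did.
  apply: is_diff_eq D _; apply/funext => v; rewrite /dradial_field -/(q x).
  congr (_ *: _ + _); rewrite -[LHS]/(h x * _ + _ * _) /= addrC; congr (_ + _).
  by rewrite mulrC.
- apply: cvgD; last first.
    by apply: cvgZ; [apply: cvgM; [exact: ch|exact: ck]|exact: cvg_cst].
  apply: cvgZ; last exact: cid.
  apply: cvgD; first by apply: cvgM; [exact: cdh|exact: ck].
  apply: cvgM; first exact: ch.
  apply: cvgM; last exact: cdot.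
  by apply: cvgM; [exact: cvg_cst|exact: ck].
Qed.

(** The Jacobian is a rank one matrix plus a multiple of the identity. Its trace against P yields a
    pairing of the projected gradient with x - xi, a multiple of tr P, and the quadratic form of P
    at x - xi, which is the squared norm of the projection since P is symmetric and idempotent. *)
Lemma divergence_radial (P : 'M[R]_n.+1) xi h dh g g' (x : E) :
  P^T = P -> P *m P = P ->
  divergence P (dradial_field xi h dh g g' x) =
  g (dot (x - xi) (x - xi)) * dot (gradient (dh x) *m P) (x - xi) +
  h x * (2 * g' (dot (x - xi) (x - xi)) * enorm ((x - xi) *m P) ^+ 2
         + g (dot (x - xi) (x - xi)) * \tr P).
Proof.
move=> symP idemP.
rewrite enorm_proj_sqr// -[dot _ (_ *m P)]dot_proj// /divergence /mxtrace.
set y := x - xi; set a := g _; set b := 2 * _.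
have -> : \sum_i (P *m lin1_mx (dradial_field xi h dh g g' x)) i i =
   \sum_i \sum_j (a * (dh x (delta_mx 0 j) * P j i * y 0 i) +
      h x * (b * (P i j * y 0 j * y 0 i) + a * (P i j * (i == j)%:R))).
  apply: eq_bigr => i _; rewrite mxE; apply: eq_bigr => j _.
  rewrite !mxE.
  rewrite -/y -/a -/b /=.
  have -> : dot y (delta_mx 0 j) = x 0 j - xi 0 j.
    rewrite dotE (bigD1 j)//= big1 => [|k kj].
      by rewrite !mxE !eqxx mulr1 addr0.
    by rewrite !mxE (negbTE kj) andbF mulr0.
  have -> : P i j = P j i by rewrite -[in LHS]symP mxE.
  by ring.
under eq_bigr do rewrite big_split/= -!mulr_sumr big_split/= -!mulr_sumr.
rewrite big_split/= -!mulr_sumr big_split/= -!mulr_sumr; congr (_ * _ + _ * (_ * _ + _ * _)).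
- rewrite dotE; apply: eq_bigr => i _; rewrite [(_ *m _) 0 i]mxE mulr_suml; apply: eq_bigr => j _.
  by rewrite [gradient _ 0 j]mxE; ring.
- rewrite dotE; apply: eq_bigr => i _; rewrite [(_ *m _) 0 i]mxE mulr_suml; apply: eq_bigr => j _.
  have -> : P j i = P i j by rewrite -[in LHS]symP mxE.
  by ring.
- apply: eq_bigr => i _; rewrite (bigD1 i)//= eqxx mulr1 big1 ?addr0// => j ji.
  by rewrite eq_sym (negbTE ji) mulr0.
Qed.

End radial_field.

(** * Borel measurability of continuous and matrix-valued maps *)

Section borel_sets.
Context {R : realType} {T : ptopologicalType}.

Lemma closed_borel (A : set T) : closed A -> measurable (A : set (borel T)).
Proof.
move=> cA; rewrite -[A]setCK; apply: measurableC; apply: sub_sigma_algebra.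
exact: closed_openC.
Qed.

Lemma within_continuous_borel (D : set T) (f : T -> R) :
  closed D -> {within D, continuous f} ->
  measurable_fun (D : set (borel T)) (f : borel T -> R).
Proof.
move=> cD /continuousP cf.
apply: (measurability _ (RGenOpens.measurableE R)) => _ [_ [a [b ->] <-]].
have /open_subspaceP [U oU UD] := cf _ (@interval_open _ (BRight a) (BLeft b) isT isT).
rewrite (_ : _ `&` _ = U `&` D); last by rewrite UD setIC.
apply: measurableI; last exact: closed_borel.
exact: sub_sigma_algebra.
Qed.

Lemma continuous_borel (f : T -> R) :
  continuous f -> measurable_fun [set: borel T] (f : borel T -> R).
Proof.
move=> cf; apply: within_continuous_borel; first exact: closedT.
exact: continuous_subspaceT.
Qed.

End borel_sets.

Section measurable_matrix.
Context {R : realType} d {X : measurableType d}.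
Implicit Types D : set X.

Lemma measurable_coord p q D (F : X -> borel 'M[R]_(p, q)) i j :
  measurable_fun D F -> measurable_fun D (fun x => (F x : 'M[R]_(p, q)) i j).
Proof.
move=> mF; have mc : measurable_fun [set: borel 'M[R]_(p, q)]
    (fun A : borel 'M[R]_(p, q) => (A : 'M[R]_(p, q)) i j).
  by apply: continuous_borel; exact: coord_continuous.
exact: (measurableT_comp mc mF).
Qed.

Lemma measurable_dot N D (F G : X -> 'rV[R]_N) :
  (forall i, measurable_fun D (fun x => F x 0 i)) ->
  (forall i, measurable_fun D (fun x => G x 0 i)) ->
  measurable_fun D (fun x => dot (F x) (G x)).
Proof.
move=> mF mG; under eq_fun do rewrite dotE.
by apply: measurable_sum => i; exact: measurable_funM.
Qed.

Lemma measurable_enorm N D (F : X -> 'rV[R]_N) :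
  (forall i, measurable_fun D (fun x => F x 0 i)) ->
  measurable_fun D (fun x => enorm (F x)).
Proof.
move=> mF; have ms : measurable_fun [set: R] (@Num.sqrt R).
  by apply: continuous_measurable_fun; exact: sqrt_continuous.
exact: (measurableT_comp ms (measurable_dot mF mF)).
Qed.

Lemma measurable_mulmx p q N D (F : X -> 'M[R]_(p, q)) (G : X -> 'M[R]_(q, N)) :
  (forall i j, measurable_fun D (fun x => F x i j)) ->
  (forall i j, measurable_fun D (fun x => G x i j)) ->
  forall i j, measurable_fun D (fun x => (F x *m G x) i j).
Proof.
move=> mF mG i j; under eq_fun do rewrite mxE.
by apply: measurable_sum => k; exact: measurable_funM.
Qed.

(** Equality is the vanishing of one measurable function, the sum of the squared entry differences.
    This makes the graph of a plane field measurable. *)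
Lemma measurable_matrix_eq p q (F G : X -> 'M[R]_(p, q)) :
  (forall i j, measurable_fun setT (fun x => F x i j)) ->
  (forall i j, measurable_fun setT (fun x => G x i j)) ->
  measurable [set x | F x = G x].
Proof.
move=> mF mG.
pose f x := \sum_i \sum_j (F x i j - G x i j) ^+ 2.
have -> : [set x | F x = G x] = f @^-1` [set 0].
  apply/seteqP; split => x /=; [move=> FG|].
    by rewrite /f big1 // => i _; rewrite big1// => j _; rewrite FG subrr expr0n.
  rewrite /f; move/eqP; rewrite psumr_eq0 => [/allP H|i _]; last first.
    by rewrite sumr_ge0// => j _; exact: sqr_ge0.
  apply/matrixP => i j; have := H i (mem_index_enum _) => /=.
  rewrite psumr_eq0 => [/allP/(_ j (mem_index_enum _))|k _]; last exact: sqr_ge0.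
  by rewrite /= sqrf_eq0 subr_eq0 => /eqP.
rewrite -[X in measurable X]setTI.
have mf : measurable_fun setT f; last exact: mf.
apply: measurable_sum => i; apply: measurable_sum => j.
by apply: measurable_funX; exact: measurable_funB.
Qed.

End measurable_matrix.

(** * Compactness of the Grassmannian and of the bundle over a bounded set *)

Section grassmannian_topology.
Context {R : realType} {n : nat}.
Local Notation E := 'rV[R]_n.+1.
Local Notation M := 'M[R]_n.+1.

Lemma grassmannian_trace (m : nat) (P : M) : grassmannian m P -> \tr P = m%:R.
Proof. by move=> [_ idemP <-]; exact: mxtrace_idem. Qed.

(** From P = P P^T, the squares in row k sum to the diagonal entry P k k. Hence (P k k)^2 <= P k k
    <= 1, and every entry of the row has square at most 1. *)
Lemma grassmannian_entry_le1 (m : nat) (P : M) i j :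
  grassmannian m P -> `|P i j| <= 1.
Proof.
move=> [symP idemP _].
have H k : \sum_l P k l ^+ 2 = P k k.
  rewrite -[in RHS]idemP mxE; apply: eq_bigr => l _.
  by rewrite -[in X in _ = _ * X]symP mxE expr2.
have le k l : P k l ^+ 2 <= P k k.
  by rewrite -H (bigD1 l)//= lerDl sumr_ge0// => ? _; exact: sqr_ge0.
have Pii1 : P i i <= 1.
  by have := le i i; rewrite leNgt => h; rewrite leNgt; apply: contra h => h; nra.
rewrite -(@ler_pXn2r _ 2)// ?nnegrE// expr1n real_normK ?num_real//.
exact: le_trans (le i j) Pii1.
Qed.

Lemma closed_idempotent_trace (c : R) :
  closed [set P : M | [/\ P^T = P, P *m P = P & \tr P = c]].
Proof.
have coord (i j : 'I_n.+1) : continuous (fun P : M => P i j).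
  exact: coord_continuous.
have csum (f : 'I_n.+1 -> M -> R) : (forall i, continuous (f i)) ->
    continuous (fun P => \sum_i f i P).
  move=> cf P; rewrite (_ : (fun _ => _) = \sum_i f i); last first.
    by apply/funext => Q; rewrite fct_sumE.
  by elim/big_ind : _ => [|k l ck cl|i _];
    [exact: cst_continuous|exact: continuousD|exact: cf].
have ceq (f g : M -> R) : continuous f -> continuous g ->
    closed [set P | f P = g P].
  move=> cf cg; rewrite (_ : [set P | _] = (f - g) @^-1` [set 0]).
    apply: closed_comp => [P _|]; last exact/accessible_closed_set1/hausdorff_accessible/Rhausdorff.
    by apply: continuousB; [exact: cf|exact: cg].
  apply/seteqP; split => P /=; first by move=> e; rewrite -[LHS]/(f P - g P) e subrr.
  by move=> e; apply/eqP; rewrite -subr_eq0; apply/eqP.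
have -> : [set P : M | [/\ P^T = P, P *m P = P & \tr P = c]] =
  (\bigcap_i \bigcap_j [set P : M | P j i = P i j]) `&`
  (\bigcap_i \bigcap_j [set P : M | \sum_k P i k * P k j = P i j]) `&`
  [set P : M | \sum_i P i i = c].
  apply/seteqP; split => [P [sP iP tP]|P [[sP iP] tP]].
    split => //; split => i _ j _ /=.
      by rewrite -[in RHS]sP mxE.
    by rewrite -[in RHS]iP mxE.
  split => //; apply/matrixP => i j; rewrite mxE.
    exact: sP.
  exact: iP.
apply: closedI; last by apply: ceq; [apply: csum => i; exact: coord|exact: cst_continuous].
apply: closedI; apply: closed_bigI => i _; apply: closed_bigI => j _.
  by apply: ceq; exact: coord.
apply: ceq; last exact: coord.
by apply: csum => k P; apply: continuousM; exact: coord.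
Qed.

Lemma compact_matrix_box : compact [set P : M | forall i j, `|P i j| <= 1].
Proof.
pose A := [set v : 'rV[R]_(n.+1 * n.+1) | forall i, `[(- 1 : R), 1]%classic (v ord0 i)].
have cA : compact A.
  by apply: (@rV_compact _ _ (fun=> `[(- 1 : R), 1]%classic)) => i; exact: segment_compact.
have -> : [set P : M | forall i j, `|P i j| <= 1] = vec_mx @` A.
  apply/seteqP; split => [P PA|_ [v Av <-] i j].
    exists (mxvec P); last exact: mxvecK.
    move=> k; case/mxvec_indexP: k => i j; rewrite /= in_itv/= mxvecE -ler_norml.
    exact: PA.
  by have := Av (mxvec_index i j); rewrite /= in_itv/= -ler_norml mxE.
apply: continuous_compact cA; apply: continuous_subspaceT => v.
move=> B /nbhs_ballP[e e0 eB]; apply/nbhs_ballP; exists e => // w [_ vw].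
by apply: eB; split => // i j; rewrite !mxE; exact: vw.
Qed.

(** The rank is not continuous, but on idempotents it equals the trace; after this exchange every
    defining condition is a closed one. *)
Lemma grassmannianE (m : nat) : grassmannian m =
  [set P : M | [/\ P^T = P, P *m P = P & \tr P = m%:R]].
Proof.
apply/seteqP; split => P; first by move=> G; have [? ? _] := G; split => //; exact: grassmannian_trace.
by move=> [sP iP]; rewrite mxtrace_idem// => /eqP; rewrite eqr_nat => /eqP.
Qed.

Lemma closed_grassmannian (m : nat) : closed (grassmannian m : set M).
Proof. by rewrite grassmannianE; exact: closed_idempotent_trace. Qed.

Lemma compact_grassmannian (m : nat) : compact (grassmannian m : set M).
Proof.
apply: (subclosed_compact (@closed_grassmannian m) compact_matrix_box) => P G i j.
exact: grassmannian_entry_le1 G.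
Qed.

Lemma compact_closure_bounded (A : set E) : bounded_set A -> compact (closure A).
Proof.
move=> [c [cr cA]]; apply: bounded_closed_compact; last exact: closed_closure.
exists c; split => // k ck x Ax.
have : closure A `<=` [set y : E | `|y| <= k].
  have cB : closed [set y : E | `|y| <= k].
    apply: (@closed_comp _ _ (fun y : E => `|y|) [set r : R | r <= k]) => [y _|].
      exact: norm_continuous.
    exact: closed_le.
  by rewrite [X in _ `<=` X](closure_id _).1//; apply: closureS => y Ay; exact: cA.
exact.
Qed.

Lemma compact_grass_bundle (A : set E) m :
  bounded_set A -> compact (grass_bundle A m).
Proof.
move=> bA; apply: compact_setX; first exact: compact_closure_bounded.
exact: compact_grassmannian.
Qed.

Lemma closed_grass_bundle (A : set E) m :
  bounded_set A -> closed (grass_bundle A m).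
Proof.
move=> bA; apply: compact_closed; last exact: compact_grass_bundle.
exact: norm_hausdorff.
Qed.

End grassmannian_topology.

(** * The corrected tangent plane field *)

Section plane_field.
Context {R : realType} {n : nat} (m : nat).
Local Notation E := 'rV[R]_n.+1.
Local Notation M := 'M[R]_n.+1.
Variable T : E -> M.

(* The tangent plane field, corrected to be a field of orthogonal projections
   at every point. *)
Definition plane (x : E) : M := if T x \in grassmannian m then T x else 0.

Lemma plane_sym x : (plane x)^T = plane x.
Proof. by rewrite /plane; case: ifPn => [/set_mem[]|_]; rewrite ?trmx0. Qed.

Lemma plane_idem x : plane x *m plane x = plane x.
Proof. by rewrite /plane; case: ifPn => [/set_mem[]|_]; rewrite ?mulmx0. Qed.

Hypothesis mT : measurable_fun [set: borel E] (T : borel E -> borel M).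

Lemma measurable_grass : measurable ([set x | grassmannian m (T x)] : set (borel E)).
Proof.
rewrite -[X in measurable X]setTI; apply: mT => //.
by apply: closed_borel; exact: closed_grassmannian.
Qed.

Lemma measurable_plane i j :
  measurable_fun [set: borel E] (fun x : borel E => plane x i j).
Proof.
rewrite (_ : (fun x => _) = (fun x : borel E => (T x : M) i j) \_ [set x | grassmannian m (T x)]).
  apply/(measurable_restrictT _ measurable_grass).
  by apply: (@measurable_funS _ _ _ _ setT) => //; exact: measurable_coord.
apply/funext => x; rewrite patchE /plane /in_mem/= /in_set/=.
by case: ifPn => // _; rewrite mxE.
Qed.

End plane_field.

(** * From the varifold to its weight measure *)

Section varifold_measure.
Context {R : realType} {n : nat}.
Local Notation E := 'rV[R]_n.+1.
Local Notation M := 'M[R]_n.+1.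
Variables (Omega : set E) (m : nat) (V : {measure set (borel (E * M)%type) -> \bar R}).
Hypotheses (bOmega : bounded_set Omega) (varV : varifold Omega m V).

Local Notation D := (closure Omega).

Lemma measurable_closure : measurable (D : set (borel E)).
Proof. by apply: closed_borel; exact: closed_closure. Qed.

(** The bundle over a bounded domain is compact, so a Radon measure concentrated on it is finite. *)
Lemma varifold_finite : (V setT < +oo)%E.
Proof.
have [radV [N [mN N0 KN]]] := varV.
have mK : measurable (grass_bundle Omega m : set (borel (E * M)%type)).
  by apply: closed_borel; exact: closed_grass_bundle.
have -> : [set: borel (E * M)%type] = grass_bundle Omega m `|` N.
  apply/seteqP; split => // z _; have [Kz|Kz] := pselect (grass_bundle Omega m z).
    by left.
  by right; exact: KN.
apply: (le_lt_trans (measureU2 _ mK mN)).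
by rewrite [X in (_ + X)%E]N0 adde0; apply: radV; exact: compact_grass_bundle.
Qed.

Lemma weight_finite : fin_num_fun (weight V).
Proof.
apply: lty_fin_num_fun.
exact: varifold_finite.
Qed.

Section tangent.
Variables (S : set E) (theta : E -> R) (T : E -> M).
Hypothesis rectV : rectifiable_varifold Omega m V S theta T.

Let mT : measurable_fun [set: borel E] (T : borel E -> borel M).
Proof. by case: rectV. Qed.

(** The complement of the graph of T pulls back to the empty set under x |-> (x, T x), so the
    integral formula for V makes it null. On the graph, concentration of V on the bundle puts T x in
    the Grassmannian. *)
Lemma rectifiable_ae_tangent :
  {ae V, forall z, [/\ D z.1, z.2 = T z.1 & grassmannian m (T z.1)]}.
Proof.
have [_ [N [mN N0 KN]]] := varV.
pose G : set (borel (E * M)%type) := [set z | z.2 = T z.1].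
have mG : measurable G.
  apply: measurable_matrix_eq => i j.
    have c : continuous (fun z : E * M => z.2 i j).
      move=> z; apply: (@continuous_comp _ _ _ snd (fun A : M => A i j)).
        exact: cvg_snd.
      exact: coord_continuous.
    exact: continuous_borel c.
  apply: measurable_coord; apply: (measurableT_comp mT).
  exact: measurable_borel_fst.
have GC0 : V (~` G) = 0%E.
  have [_ _ _ _ VE] := rectV; rewrite VE; last exact: measurableC.
  rewrite (_ : _ `&` _ = set0) ?integral_set0//.
  by apply/seteqP; split => x //= -[_]; exact.
exists (N `|` ~` G); split.
- by apply: measurableU => //; exact: measurableC.
- by apply: null_set_setU => //; exact: measurableC.
- move=> z zG; have [Kz|Kz] := pselect (grass_bundle Omega m z); last first.
    by left; exact: KN.
  have [Gz|Gz] := pselect (G z); last by right.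
  by exfalso; apply: zG; case: Kz => /= Dz gz; split => //; rewrite -Gz.
Qed.

Lemma weight_ae_grass : {ae weight V, forall x, grassmannian m (T x)}.
Proof.
have [N [mN N0 NE]] := rectifiable_ae_tangent.
have mC := measurableC (measurable_grass m mT).
exists (~` [set x | grassmannian m (T x)]); split => //.
rewrite -[LHS]/(V (fst @^-1` _)); apply/eqP; rewrite -measure_le0 -N0.
apply: (le_measure V); rewrite ?inE//.
  by rewrite -[X in measurable X]setTI; exact: measurable_borel_fst.
by move=> z /= zg; apply: NE => -[].
Qed.

Lemma weight_ae_plane : {ae weight V, forall x, plane m T x = T x}.
Proof.
have [N [mN N0 NE]] := weight_ae_grass; exists N; split => //.
apply: subset_trans NE; apply: subsetC => x /= gx.
by rewrite /plane; case: ifPn => // /negP[]; exact: mem_set.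
Qed.

(** For V-almost every (x, P) the plane P is T x, so the integrand depends on the base point alone
    and the integral descends along the projection to the weight measure. *)
Lemma first_variation_weight (dphi : E -> E -> E) (f : E -> R) :
  (forall v, {within D, continuous (fun x => dphi x v)}) ->
  (weight V).-integrable D (EFin \o f) ->
  (forall x, D x -> grassmannian m (T x) -> divergence (T x) (dphi x) = f x) ->
  first_variation Omega m V dphi = \int[weight V]_(x in D) f x.
Proof.
move=> cphi intf fE.
rewrite /first_variation /Rintegral; congr fine.
have mB : measurable (grass_bundle Omega m : set (borel (E * M)%type)).
  by apply: closed_borel; exact: closed_grass_bundle.
have mD := measurable_closure.
have mfst (A : set (borel E)) : measurable A ->
    measurable (fst @^-1` A : set (borel (E * M)%type)).
  by move=> mA; rewrite -[X in measurable X]setTI; exact: measurable_borel_fst.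
have mf : measurable_fun (D : set (borel E)) (EFin \o f).
  by case/integrableP : intf.
have mf' : measurable_fun [set: borel E] ((EFin \o f) \_ D).
  exact/(measurable_restrictT _ mD).
have -> : (\int[weight V]_(x in D) (f x)%:E =
    \int[V]_z (((EFin \o f) \_ D) \o fst) z)%E.
  rewrite integral_mkcond (integral_pushforward (@measurable_borel_fst R n))//.
  apply/integrableP; split.
    exact: (measurableT_comp mf' (@measurable_borel_fst R n)).
  have /integrableP[_] := (integrable_mkcond _ mD).1 intf.
  apply: le_lt_trans; rewrite le_eqVlt; apply/orP; left; apply/eqP.
  rewrite (ge0_integral_pushforward (@measurable_borel_fst R n))//.
  exact: measurableT_comp.
rewrite integral_mkcond; apply: ae_eq_integral => //.
- apply/(measurable_restrictT _ mB).
  apply/measurable_EFinP.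
  have mdphi v i : measurable_fun (grass_bundle Omega m : set (borel (E * M)%type))
      (fun z : borel (E * M)%type => dphi z.1 v 0 i).
    have c : {within D, continuous (fun x => dphi x v 0 i)}.
      move=> x; apply: (@continuous_comp (subspace D) _ _ (fun x => dphi x v) (fun u : E => u 0 i)).
        exact: cphi.
      exact: coord_continuous.
    apply: (measurable_comp mD) (within_continuous_borel _ c) _ => //.
    - by move=> _ [z [Dz _]] <-.
    - exact: closed_closure.
    - by apply: measurable_funS (@measurable_borel_fst R n).
  have mP i j : measurable_fun (grass_bundle Omega m : set (borel (E * M)%type))
      (fun z : borel (E * M)%type => z.2 i j).
    have c : continuous (fun z : E * M => z.2 i j).
      move=> z; apply: (@continuous_comp _ _ _ snd (fun A : M => A i j)).
        exact: cvg_snd.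
      exact: coord_continuous.
    by apply: (@measurable_funS _ _ _ _ setT) => //; exact: continuous_borel c.
  rewrite /divergence /mxtrace; apply: measurable_sum => i.
  apply: measurable_mulmx => // k l.
  by under eq_fun do rewrite mxE; exact: mdphi.
- exact: (measurableT_comp mf' (@measurable_borel_fst R n)).
- have [N [mN N0 NE]] := rectifiable_ae_tangent; exists N; split => //.
  apply: subset_trans NE; apply: subsetC => -[x P] /= [Dx -> gT] _.
  rewrite !patchE mem_set//= mem_set//=.
  by rewrite fE.
Qed.

End tangent.

End varifold_measure.

(** * Integrals over radial shells and Tonelli's theorem *)

Section finite_copy.
Context d (X : measurableType d) (R : realType).
Variables (mu : {measure set X -> \bar R}) (finmu : fin_num_fun mu).

(* A copy of [mu] that carries the canonical structure of finite measures. *)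
Definition finite_copy of fin_num_fun mu : set X -> \bar R := mu.

HB.instance Definition _ := Measure.on (finite_copy finmu).
HB.instance Definition _ :=
  Measure_isFinite.Build d X R (finite_copy finmu) finmu.

End finite_copy.

Section shells.
Context {R : realType}.
Local Notation leb := (@lebesgue_measure R).

Lemma is_derive_negexp (m : nat) (s : R) : (0 < m)%N -> 0 < s ->
  is_derive s 1 (fun t : R => - (m%:R^-1 * t ^- m)) (s ^- m.+1).
Proof.
move=> m0 s0.
have D1 : is_derive s 1 (fun t : R => t ^+ m) (m%:R * s ^+ m.-1).
  have := @is_deriveX _ _ id m s 1 1 (is_derive_id s 1).
  by rewrite exprfctE => D; apply: is_derive_eq D _; exact: mulr1.
have sm : s ^+ m != 0 by rewrite expf_neq0// gt_eqF.
have D2 := @is_deriveV _ (fun t : R => t ^+ m) s _ 1 sm D1.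
have D3 := is_deriveN (is_deriveZ m%:R^-1 D2).
apply: is_derive_eq D3 _.
rewrite /GRing.scale/=; case: m m0 sm {D1 D2} => // k _ _ /=.
have ? : k.+1%:R != 0 :> R by [].
have ? : s != 0 by rewrite gt_eqF.
by rewrite !exprS; field; rewrite expf_neq0//; apply/and3P.
Qed.

Lemma continuous_invX (k : nat) (t : R) :
  0 < t -> {for t, continuous (fun t : R => t ^- k)}.
Proof.
move=> t0; apply: continuousV; first by rewrite expf_neq0// gt_eqF.
exact: exprn_continuous.
Qed.

Lemma measurable_invX (k : nat) (r s : R) :
  0 < r -> measurable_fun `[r, s] (fun t : R => t ^- k).
Proof.
move=> r0; apply: subspace_continuous_measurable_fun => //.
apply: continuous_in_subspaceT => t; rewrite inE/= in_itv/= => /andP[rt _].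
by apply: continuous_invX; exact: lt_le_trans rt.
Qed.

Lemma measurable_step (s : R) (A : set R) :
  measurable_fun A (fun t : R => if s <= t then 1 else 0 : R).
Proof.
apply: (@measurable_funS _ _ _ _ setT) => //.
by apply: measurable_fun_ifT => //; exact: measurable_fun_ler.
Qed.

Lemma integral_negexp (m : nat) (r s : R) : (0 < m)%N -> 0 < r -> r <= s ->
  (\int[leb]_(t in `[r, s]) (t ^- m.+1)%:E = (m%:R^-1 * (r ^- m - s ^- m))%:E)%E.
Proof.
move=> m0 r0; rewrite le_eqVlt => /predU1P[<-|rs].
  by rewrite subrr mulr0 set_itv1 integral_set1.
have contF (t : R) : 0 < t -> {for t, continuous (fun t : R => - (m%:R^-1 * t ^- m))}.
  move=> t0; apply: continuousN; apply: continuousM; first exact: cst_continuous.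
  exact: continuous_invX.
rewrite (@continuous_FTC2 _ _ (fun t : R => - (m%:R^-1 * t ^- m)))//.
- by rewrite -EFinB; congr EFin; ring.
- apply: continuous_in_subspaceT => t; rewrite inE/= in_itv/= => /andP[rt _].
  by apply: continuous_invX; exact: lt_le_trans rt.
- split.
  + move=> t; rewrite in_itv/= => /andP[rt _].
    have D := is_derive_negexp m0 (lt_trans r0 rt); exact: (@ex_derive _ _ _ _ _ _ _ D).
  + by apply: cvg_at_right_filter; exact: contF.
  + by apply: cvg_at_left_filter; apply: contF; exact: lt_trans rs.
- move=> t; rewrite in_itv/= => /andP[rt _].
  have D := is_derive_negexp m0 (lt_trans r0 rt).
  by rewrite derive1E (@derive_val _ _ _ _ _ _ _ D).
Qed.

(** With t = max(s, r1) <= r2, the left side is s times the integral of u^-(m+1) over [t, r2]. There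
    s <= t <= u, so s u^-(m+1) <= u^-m. If t > r2 the clamp vanishes. *)
Lemma clamp_shell_le (m : nat) (r1 r2 s : R) :
  (0 < m)%N -> 0 < r1 -> r1 < r2 -> 0 <= s ->
  ((m%:R^-1 * clamp (r2 ^- m) (r1 ^- m) (Num.max s r1 ^- m) * s)%:E <=
   \int[leb]_(t in `[r1, r2]) (t ^- m * (if s <= t then 1 else 0))%:E)%E.
Proof.
move=> m0 r10 r12 s0; set t := Num.max s r1.
have r20 : 0 < r2 := lt_trans r10 r12.
have tr : r1 <= t by rewrite le_max lexx orbT.
have st : s <= t by rewrite le_max lexx.
have t0 : 0 < t := lt_le_trans r10 tr.
have pow (x y : R) : 0 < x -> x <= y -> y ^- m <= x ^- m.
  move=> x0 xy; rewrite lef_pV2 ?posrE ?exprn_gt0 ?(lt_le_trans x0)//.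
  by apply: lerXn2r; rewrite ?nnegrE ?(ltW x0) ?(le_trans (ltW x0)).
have kge0 (u : R) : `[r1, r2]%classic u ->
    (0 <= (u ^- m * (if s <= u then 1 else 0))%:E)%E.
  rewrite /= in_itv/= => /andP[ru _]; rewrite lee_fin mulr_ge0//.
    by rewrite invr_ge0 exprn_ge0// (le_trans (ltW r10)).
  by case: ifP.
rewrite /clamp (max_r (_ : t ^- m - r1 ^- m <= 0)) ?subr0; last first.
  by rewrite subr_le0 pow.
have [r2t|tr2] := ltP r2 t.
  rewrite max_r ?subr_le0 ?pow ?(ltW r2t)// mulr0 mul0r.
  exact: integral_ge0.
rewrite max_l ?subr_ge0 ?pow//.
have mk : measurable_fun `[r1, r2] (fun u : R => (u ^- m * (if s <= u then 1 else 0))%:E).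
  apply/measurable_EFinP; apply: measurable_funM.
    exact: measurable_invX.
  exact: measurable_step.
have sub : `[t, r2] `<=` `[r1, r2].
  by move=> u; rewrite /= !in_itv/= => /andP[tu ->]; rewrite (le_trans tr tu).
apply: (@le_trans _ _ (\int[leb]_(u in `[t, r2]) (u ^- m * (if s <= u then 1 else 0))%:E)%E);
  last exact: ge0_subset_integral.
apply: (@le_trans _ _ (\int[leb]_(u in `[t, r2]) (t%:E * (u ^- m.+1)%:E))%E); last first.
  apply: ge0_le_integral => //.
  - move=> u; rewrite /= in_itv/= => /andP[tu _]; rewrite -EFinM lee_fin.
    by rewrite mulr_ge0 ?(ltW t0)// invr_ge0 exprn_ge0// (le_trans (ltW t0)).
  - apply: measurable_funeM; apply/measurable_EFinP.
    exact: measurable_invX.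
  - exact: measurable_funS mk.
  - move=> u; rewrite /= in_itv/= => /andP[tu _].
    have u0 : 0 < u by exact: lt_le_trans tu.
    rewrite (le_trans st tu) mulr1 -EFinM lee_fin exprS invfM mulrA.
    by rewrite ler_piMl ?invr_ge0 ?exprn_ge0 ?(ltW u0)// ler_pdivrMr// mul1r.
rewrite ge0_integralZl//; last 3 first.
- by apply/measurable_EFinP; exact: measurable_invX.
- move=> u; rewrite /= in_itv/= => /andP[tu _]; rewrite lee_fin.
  by rewrite invr_ge0 exprn_ge0// (le_trans (ltW t0)).
- by rewrite lee_fin ltW.
rewrite integral_negexp// -EFinM lee_fin mulrC ler_wpM2r//.
by rewrite mulr_ge0 ?invr_ge0// subr_ge0 pow.
Qed.

(** Tonelli for k(t) F(x) times the indicator of rad x <= t. Measurability of the resulting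
    integrand is returned as well, since monotonicity of the integral will be applied to it. *)
Lemma tonelli_sublevel d (X : measurableType d) (mu : {measure set X -> \bar R})
    (r1 r2 : R) (k : R -> R) (rad F : X -> R) :
  fin_num_fun mu -> measurable_fun setT rad -> measurable_fun setT F ->
  (forall x, 0 <= F x) -> measurable_fun `[r1, r2] k ->
  (forall t, r1 <= t <= r2 -> 0 <= k t) ->
  measurable_fun setT (fun x => (F x)%:E * \int[leb]_(t in `[r1, r2])
    (k t * (if (rad x <= t)%R then 1 else 0))%:E)%E /\
  (\int[leb]_(t in `[r1, r2]) ((k t)%:E * \int[mu]_(x in [set x | (rad x <= t)%R]) (F x)%:E) =
   \int[mu]_x ((F x)%:E * \int[leb]_(t in `[r1, r2]) (k t * (if (rad x <= t)%R then 1 else 0))%:E))%E.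
Proof.
move=> finmu mrad mF F0 mk k0.
pose mu' : {finite_measure set X -> \bar R} := finite_copy finmu.
pose kk := k \_ `[r1, r2].
have mkk : measurable_fun setT kk by exact/(measurable_restrictT _ (measurable_itv _)).
have kk0 t : 0 <= kk t.
  rewrite /kk patchE; case: ifPn => // /set_mem; rewrite /= in_itv/=; exact: k0.
pose f (z : R * X) := (kk z.1 * (if rad z.2 <= z.1 then 1 else 0) * F z.2)%:E.
have mf : measurable_fun setT f.
  apply/measurable_EFinP; apply: measurable_funM.
    apply: measurable_funM; first exact: (measurableT_comp mkk).
    apply: measurable_fun_ifT => //; apply: measurable_fun_ler => //.
    exact: (measurableT_comp mrad).
  exact: (measurableT_comp mF).
have f0 z : (0 <= f z)%E.
  by rewrite lee_fin !mulr_ge0//; case: ifP.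
have := @fubini_tonelli _ _ _ _ _ leb mu' f mf f0.
have -> : (\int[leb]_t \int[mu']_x f (t, x) =
  \int[leb]_(t in `[r1, r2]) ((k t)%:E * \int[mu]_(x in [set x | (rad x <= t)%R]) (F x)%:E))%E.
  rewrite [RHS]integral_mkcond; apply: eq_integral => t _; rewrite patchE.
  have ms : measurable [set x | rad x <= t].
    rewrite -[X in measurable X]setTI; have := mrad measurableT _ (measurable_itv `]-oo, t]).
    by congr measurable; apply/seteqP; split => x /=; rewrite in_itv.
  case: ifPn => tr; last first.
    rewrite integral0_eq// => x _; rewrite /f/= /kk patchE (negbTE tr).
    by rewrite !mul0r.
  rewrite -ge0_integralZl//; last 3 first.
  - by apply/measurable_EFinP; exact: measurable_funS mF.
  - by move=> x _; rewrite lee_fin.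
  - by move: tr => /set_mem; rewrite /= in_itv/= => tr; rewrite lee_fin k0.
  rewrite [RHS]integral_mkcond; apply: eq_integral => x _; rewrite patchE /f /kk patchE tr/=.
  rewrite /in_mem/= /in_set/=; case: asboolP => /= h.
    by rewrite h mulr1.
  by rewrite (negbTE (introN idP h)) mulr0 mul0r.
move=> ->.
have GE : (fun x => \int[leb]_t f (t, x))%E = (fun x => (F x)%:E *
    \int[leb]_(t in `[r1, r2]) (k t * (if (rad x <= t)%R then 1 else 0))%:E)%E; last first.
  by rewrite GE; split => //; rewrite -GE; exact: measurable_fun_fubini_tonelli_G.
apply/funext => x.
rewrite -ge0_integralZl//; last 3 first.
- apply/measurable_EFinP; apply: measurable_funM => //.
  exact: measurable_step.
- move=> t; rewrite /= in_itv/= => /k0 kt; rewrite lee_fin mulr_ge0//.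
  by case: ifP.
- by rewrite lee_fin.
rewrite [RHS]integral_mkcond; apply: eq_integral => t _; rewrite patchE /f /kk/= patchE.
by case: ifPn => _; rewrite ?mul0r// -EFinM mulrC.
Qed.

End shells.

(** * Uniform bounds and the inequality for the smoothed cutoff *)

Section monotonicity.
Context {R : realType} {n : nat} (m : nat).
Local Notation E := 'rV[R]_n.+1.
Local Notation M := 'M[R]_n.+1.
Variables (Omega : set E) (beta : E -> R).
Variables (V : {measure set (borel (E * M)%type) -> \bar R}) (H : E -> E).
Variables (S : set E) (theta : E -> R) (T : E -> M).
Variables (h : E -> R) (dh : E -> E -> R) (xi : E) (r1 r2 : R).
Hypotheses (m_gt0 : (0 < m)%N) (bOmega : bounded_set Omega).
Hypothesis capV : capillary_varifold Omega beta m V H.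
Hypothesis rectV : rectifiable_varifold Omega m V S theta T.
Hypothesis h_C1 : C1_closure Omega h dh.
Hypothesis h_ge0 : forall x, closure Omega x -> 0 <= h x.
Hypotheses (r1_gt0 : 0 < r1) (r1_lt_r2 : r1 < r2).

Local Notation D := (closure Omega).
Local Notation mu := (weight V).
Local Notation a := (r2 ^- m).
Local Notation b := (r1 ^- m).
Local Notation TM := (plane m T).
Local Notation rad x := (enorm (x - xi)).
Local Notation trad x := (trunc_radius r1 (dot (x - xi) (x - xi))).
Local Notation cutr d x := (cut d a b (trad x ^- m)).
Local Notation dcutr d x := (dcut d a b (trad x ^- m)).

Let varV : varifold Omega m V. Proof. by case: capV. Qed.

Let mD : measurable (D : set (borel E)). Proof. exact: measurable_closure. Qed.

Let cD : closed D. Proof. exact: closed_closure. Qed.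

Let kD : compact D. Proof. exact: compact_closure_bounded. Qed.

Let mDT (f : E -> R) : continuous f -> measurable_fun (D : set (borel E)) (f : borel E -> R).
Proof. by move=> cf; apply: (@measurable_funS _ _ _ _ setT) => //; exact: continuous_borel. Qed.

Let r2_gt0 : 0 < r2. Proof. exact: lt_trans r1_lt_r2. Qed.

Let a_lt_b : a < b.
Proof.
by rewrite ltf_pV2 ?posrE ?exprn_gt0// ltr_pXn2r ?nnegrE ?ltW.
Qed.

Let a_gt0 : 0 < a.
Proof. by rewrite invr_gt0 exprn_gt0. Qed.

Let tradE x : trad x = Num.max (rad x) r1. Proof. by []. Qed.

Let trad_ge x : r1 <= trad x. Proof. by rewrite tradE le_max lexx orbT. Qed.

Let trad_gt0 x : 0 < trad x. Proof. exact: lt_le_trans (trad_ge x). Qed.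

Let trad_le_b x : 0 <= trad x ^- m <= b.
Proof.
rewrite invr_ge0 exprn_ge0 ?(ltW (trad_gt0 x))//= lef_pV2 ?posrE ?exprn_gt0// ?trad_gt0//.
by rewrite ler_pXn2r ?nnegrE ?(ltW r1_gt0) ?(ltW (trad_gt0 x))// trad_ge.
Qed.

Let Fint (x : E) := h x * enorm (H x) + enorm (gradient (dh x) *m TM x).

(* [fd] is the divergence of the test field along the tangent plane, [wd] its
   product with the mean curvature, [Bd] a lower bound of [fd + wd] and [B] the
   pointwise limit of [Bd]. *)
Let fd d (x : E) := m%:R^-1 * cutr d x * dot (gradient (dh x) *m TM x) (x - xi) +
  h x * (cutr d x - dcutr d x * trad x ^- (m + 2) * enorm ((x - xi) *m TM x) ^+ 2).

Let wd d (x : E) := m%:R^-1 * (h x * cutr d x) * dot (H x) (x - xi).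

Let Bd d (x : E) :=
  h x * (cutr d x - dcutr d x * trad x ^- (m + 2) * enorm ((x - xi) *m TM x) ^+ 2)
  - m%:R^-1 * cutr d x * rad x * Fint x.

Let B (x : E) := h x * (clamp a b (trad x ^- m) -
    (if (r1 < rad x <= r2) then 1 else 0) * trad x ^- (m + 2) * enorm ((x - xi) *m TM x) ^+ 2)
  - m%:R^-1 * clamp a b (trad x ^- m) * rad x * Fint x.

(** A bound uniform in d: the clamp is at most b, and smoothing adds at most d <= 1. *)
Let cutr_le d x : 0 < d <= 1 -> 0 <= cutr d x <= b + 1.
Proof.
move=> /andP[d0 d1]; have /andP[u0 ub] := trad_le_b x.
have ab := a_lt_b; have a0 := a_gt0.
have := cut_clamp a b (trad x ^- m) d0; rewrite ler_norml => /andP[_ cl].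
apply/andP; split.
  by rewrite subr_ge0 ramp_homo// lerB// ltW.
have : clamp a b (trad x ^- m) <= b.
  rewrite /clamp (max_r (_ : _ - b <= 0)) ?subr_le0// subr0 ge_max; lra.
lra.
Qed.

Let continuous_rad : continuous (fun x : E => dot (x - xi) (x - xi)).
Proof.
have csub : continuous (fun x : E => x - xi).
  by move=> x; apply: continuousB; [exact: (fun A => id)|exact: cst_continuous].
by move=> x; exact: (continuous_dot (@csub x) (@csub x)).
Qed.

Let continuous_tradX k : continuous (fun x : E => trad x ^- k).
Proof.
by move=> x; exact: (continuous_comp (@continuous_rad x)
  (@continuous_trunc_radius_exp _ _ r1_gt0 k _)).
Qed.

Let mtradX k : measurable_fun (D : set (borel E)) (fun x : borel E => trad x ^- k).
Proof. exact: mDT (@continuous_tradX k). Qed.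

Let mcut d : 0 < d -> measurable_fun (D : set (borel E)) (fun x : borel E => cutr d x).
Proof.
move=> d0; apply: mDT => x.
exact: (continuous_comp (@continuous_tradX m x) (@continuous_cut _ d a b d0 _)).
Qed.

Let mdcut d : measurable_fun (D : set (borel E)) (fun x : borel E => dcutr d x).
Proof.
apply: mDT => x.
exact: (continuous_comp (@continuous_tradX m x) (@continuous_dcut _ d a b _)).
Qed.

Let mxi i : measurable_fun (D : set (borel E)) (fun x : borel E => ((x : E) - xi) 0 i).
Proof.
apply: mDT => x.
have csub : continuous (fun x : E => x - xi).
  by move=> y; apply: continuousB; [exact: (fun A => id)|exact: cst_continuous].
exact: (continuous_comp (@csub x) (@coord_continuous _ _ _ 0 i _)).
Qed.

Let mrad : measurable_fun (D : set (borel E)) (fun x : borel E => rad x).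
Proof. by apply: measurable_enorm => i; exact: mxi. Qed.

Let mT : measurable_fun [set: borel E] (T : borel E -> borel M).
Proof. by case: rectV. Qed.

Let mTM i j : measurable_fun (D : set (borel E)) (fun x : borel E => TM x i j).
Proof. by apply: (@measurable_funS _ _ _ _ setT) => //; exact: measurable_plane. Qed.

Let mh : measurable_fun (D : set (borel E)) (h : borel E -> R).
Proof. by case: h_C1 => ch _ _; exact: within_continuous_borel. Qed.

Let mgrad i : measurable_fun (D : set (borel E)) (fun x : borel E => gradient (dh x) 0 i).
Proof.
under eq_fun do rewrite mxE.
by case: h_C1 => _ _ cdh; exact: within_continuous_borel.
Qed.

Let mgradT i : measurable_fun (D : set (borel E)) (fun x : borel E => (gradient (dh x) *m TM x) 0 i).
Proof. by apply: measurable_mulmx => // k l; rewrite ord1. Qed.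

Let mradT i : measurable_fun (D : set (borel E)) (fun x : borel E => (((x : E) - xi) *m TM x) 0 i).
Proof. by apply: measurable_mulmx => // k l; rewrite ord1. Qed.

Let mH i : measurable_fun (D : set (borel E)) (fun x : borel E => H x 0 i).
Proof. by apply: measurable_coord; case: capV. Qed.

Let mF : measurable_fun (D : set (borel E)) (Fint : borel E -> R).
Proof.
apply: measurable_funD; last exact: measurable_enorm.
by apply: measurable_funM => //; exact: measurable_enorm.
Qed.

Let bounded_on_D (f : E -> R) : {within D, continuous f} ->
  exists2 C, 0 <= C & forall x, D x -> `|f x| <= C.
Proof.
move=> cf; have [C [_ CP]] := compact_bounded (continuous_compact cf kD).
exists (`|C| + 1); first by rewrite addr_ge0.
move=> x Dx; apply: CP; last by exists x.
by rewrite (le_lt_trans (ler_norm _))// ltrDl.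
Qed.

Let h_bounded : exists2 C, 0 <= C & forall x, D x -> h x <= C.
Proof.
have [C C0 CP] : exists2 C, 0 <= C & forall x, D x -> `|h x| <= C.
  by apply: bounded_on_D; case: h_C1.
by exists C => // x Dx; rewrite (le_trans (ler_norm _))// CP.
Qed.

Let rad_bounded : exists2 C, 0 <= C & forall x, D x -> rad x <= C.
Proof.
have [C C0 CP] : exists2 C, 0 <= C & forall x, D x -> `|rad x| <= C.
  apply: bounded_on_D; apply: continuous_subspaceT => x.
  exact: (continuous_comp (@continuous_rad x) (@sqrt_continuous _ _)).
by exists C => // x Dx; rewrite (le_trans (ler_norm _))// CP.
Qed.

Let grad_bounded : exists2 C, 0 <= C & forall x, D x -> enorm (gradient (dh x) *m TM x) <= C.
Proof.
have [C C0 CP] : exists2 C, 0 <= C &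
    forall x, D x -> `|dot (gradient (dh x)) (gradient (dh x))| <= C.
  apply: bounded_on_D.
  rewrite (_ : (fun x => _) = \sum_i (fun x => dh x (delta_mx 0 i) ^+ 2)); last first.
    by apply/funext => x; rewrite fct_sumE dotE; apply: eq_bigr => i _; rewrite mxE.
  case: h_C1 => _ _ cdh x.
  elim/big_ind : _ => [|k l ck cl|i _].
  - exact: cst_continuous.
  - exact: continuousD.
  - by apply: continuousM; exact: cdh.
exists (Num.sqrt C); first exact: sqrtr_ge0.
move=> x Dx; apply: le_trans (enorm_proj_le (plane_sym _ _ _) (plane_idem _ _ _) _) _.
by rewrite ler_wsqrtr// (le_trans (ler_norm _))// CP.
Qed.

Let fin_mu : (mu D < +oo)%E.
Proof. by rewrite -ge0_fin_numE ?measure_ge0//; exact: (weight_finite bOmega varV). Qed.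

Let int_bounded (f : E -> R) C : measurable_fun (D : set (borel E)) (f : borel E -> R) ->
  (forall x, D x -> `|f x| <= C) -> mu.-integrable D (EFin \o f).
Proof.
move=> mf fC; apply: measurable_bounded_integrable => //.
by exists C; split; [exact: num_real|move=> c Cc x Dx; apply: le_trans (fC _ Dx) _; exact: ltW].
Qed.

Let int_H : mu.-integrable D (fun x => (enorm (H x))%:E).
Proof. by case: capV => _ _ /(_ D kD) + _ _; rewrite setIid. Qed.

Let F_ge0 x : D x -> 0 <= Fint x.
Proof. by move=> Dx; rewrite addr_ge0// ?enorm_ge0// mulr_ge0 ?enorm_ge0// h_ge0. Qed.

Let int_F : mu.-integrable D (EFin \o Fint).
Proof.
have [C C0 CP] := grad_bounded; have [Ch Ch0 ChP] := h_bounded.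
have -> : EFin \o Fint = ((fun x => (h x * enorm (H x))%:E) \+
    (fun x => (enorm (gradient (dh x) *m TM x))%:E))%E by [].
apply: integrableD => //.
- have int_hH : mu.-integrable D (fun x => Ch%:E * (enorm (H x))%:E)%E.
    exact: integrableZl.
  apply: (le_integrable mD _ _ int_hH).
  + by apply/measurable_EFinP; apply: measurable_funM => //; exact: measurable_enorm.
  + move=> x Dx; rewrite -EFinM !abse_EFin lee_fin !normrM.
    by rewrite (ger0_norm (h_ge0 Dx)) (ger0_norm Ch0) ler_wpM2r// ChP.
- apply: (@int_bounded _ C) => [|x Dx]; first exact: measurable_enorm.
  by rewrite ger0_norm ?enorm_ge0// CP.
Qed.

Let mBd d : 0 < d -> measurable_fun (D : set (borel E)) (Bd d : borel E -> R).
Proof.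
move=> d0; apply: measurable_funB.
  apply: measurable_funM => //; apply: measurable_funB; first exact: mcut.
  apply: measurable_funM; first by apply: measurable_funM; [exact: mdcut|exact: mtradX].
  by apply: measurable_funX; exact: measurable_enorm.
apply: measurable_funM => //; apply: measurable_funM => //.
by apply: measurable_funM => //; exact: mcut.
Qed.

(** Since the truncated radius is at least r1, the kernel stays below r1^-(m+2) even at the centre.
    The factor e stands for any value of [dcutr], so the bound is independent of d. *)
Let bracket_bounded : exists2 C, 0 <= C & forall d e x, 0 < d <= 1 -> `|e| <= 1 -> D x ->
  `|cutr d x - e * trad x ^- (m + 2) * enorm ((x - xi) *m TM x) ^+ 2| <= C.
Proof.
have [C C0 CP] := rad_bounded.
exists (b + 1 + r1 ^- (m + 2) * C ^+ 2).
  by rewrite addr_ge0// ?mulr_ge0 ?invr_ge0 ?exprn_ge0// ?addr_ge0 ?invr_ge0 ?exprn_ge0// ltW.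
move=> d e x d01 e1 Dx; have /andP[c0 cb] := cutr_le x d01.
apply: le_trans (ler_normB _ _) _; apply: lerD; first by rewrite ger0_norm.
rewrite !normrM normfV !normrX (gtr0_norm (trad_gt0 x)).
rewrite (ger0_norm (enorm_ge0 _)) ler_pM// ?mulr_ge0 ?invr_ge0 ?exprn_ge0 ?enorm_ge0//.
- exact: ltW (trad_gt0 x).
- rewrite -[leRHS]mul1r ler_pM// ?invr_ge0 ?exprn_ge0 ?(ltW (trad_gt0 x))//.
  rewrite lef_pV2 ?posrE ?exprn_gt0 ?trad_gt0//.
  by apply: lerXn2r; rewrite ?nnegrE ?(ltW r1_gt0) ?(ltW (trad_gt0 x)) ?trad_ge.
- suff le : enorm ((x - xi) *m TM x) <= C by rewrite expr2 ler_pM ?enorm_ge0.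
  apply: le_trans (CP _ Dx).
  exact: (enorm_proj_le (plane_sym _ _ _) (plane_idem _ _ _)).
Qed.

(** The majorant is a constant plus a multiple of [Fint], integrable because the measure is finite
    and H is integrable on the compact closure. *)
Let dominated : exists2 G : E -> R, mu.-integrable D (EFin \o G) &
  forall d x, 0 < d <= 1 -> D x -> `|Bd d x| <= G x.
Proof.
have [C C0 CP] := bracket_bounded; have [Ch Ch0 ChP] := h_bounded.
have [Cr Cr0 CrP] := rad_bounded.
exists (fun x => Ch * C + m%:R^-1 * (b + 1) * Cr * Fint x).
  have -> : EFin \o (fun x => Ch * C + m%:R^-1 * (b + 1) * Cr * Fint x) =
    ((fun=> (Ch * C)%:E) \+ (fun x => (m%:R^-1 * (b + 1) * Cr)%:E * (Fint x)%:E))%E by [].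
  apply: integrableD => //; last exact: integrableZl.
  by apply: (@int_bounded _ `|Ch * C|) => //; exact: measurable_cst.
move=> d x d01 Dx; have /andP[d0 d1] := d01.
have /andP[c0 cb] := cutr_le x d01.
apply: le_trans (ler_normB _ _) _; apply: lerD.
  rewrite normrM (ger0_norm (h_ge0 Dx)) ler_pM// ?h_ge0 ?ChP// CP//.
  exact: dcut_norm_le1.
rewrite !normrM (ger0_norm (F_ge0 Dx)) ler_wpM2r ?F_ge0// (ger0_norm c0).
rewrite (ger0_norm (enorm_ge0 _)) normfV normr_nat.
by rewrite !ler_pM ?mulr_ge0 ?invr_ge0 ?enorm_ge0 ?CrP.
Qed.

Let int_Bd d : 0 < d <= 1 -> mu.-integrable D (EFin \o Bd d).
Proof.
move=> d01; have /andP[d0 _] := d01; have [G intG BG] := dominated.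
apply: (le_integrable mD _ _ intG); first by apply/measurable_EFinP; exact: mBd.
move=> x Dx; rewrite !abse_EFin lee_fin (le_trans (BG _ _ d01 Dx))//.
exact: ler_norm.
Qed.

Let int_fd d : 0 < d <= 1 -> mu.-integrable D (EFin \o fd d).
Proof.
move=> d01; have /andP[d0 _] := d01.
have [C C0 CP] := bracket_bounded; have [Ch Ch0 ChP] := h_bounded.
have [Cr Cr0 CrP] := rad_bounded; have [Cg Cg0 CgP] := grad_bounded.
apply: (@int_bounded _ (m%:R^-1 * (b + 1) * (Cg * Cr) + Ch * C)).
  apply: measurable_funD.
    apply: measurable_funM; last exact: measurable_dot.
    by apply: measurable_funM => //; exact: mcut.
  apply: measurable_funM => //; apply: measurable_funB; first exact: mcut.
  apply: measurable_funM; first by apply: measurable_funM; [exact: mdcut|exact: mtradX].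
  by apply: measurable_funX; exact: measurable_enorm.
move=> x Dx; have /andP[c0 cb] := cutr_le x d01.
apply: le_trans (ler_normD _ _) _; apply: lerD.
  rewrite !normrM (ger0_norm c0) normfV normr_nat ler_pM ?mulr_ge0 ?invr_ge0//.
    by rewrite ler_wpM2l.
  by rewrite (le_trans (normr_dot_le _ _))// ler_pM ?enorm_ge0 ?CrP ?CgP.
rewrite normrM (ger0_norm (h_ge0 Dx)) ler_pM// ?h_ge0 ?ChP// CP//.
exact: dcut_norm_le1.
Qed.

Let int_wd d : 0 < d <= 1 -> mu.-integrable D (EFin \o wd d).
Proof.
move=> d01; have /andP[d0 _] := d01.
have [Ch Ch0 ChP] := h_bounded; have [Cr Cr0 CrP] := rad_bounded.
have intG : mu.-integrable D (fun x => (m%:R^-1 * (Ch * (b + 1)) * Cr)%:E * (enorm (H x))%:E)%E.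
  exact: integrableZl.
apply: (le_integrable mD _ _ intG).
  apply/measurable_EFinP; apply: measurable_funM; last exact: measurable_dot.
  by apply: measurable_funM => //; apply: measurable_funM => //; exact: mcut.
move=> x Dx; have /andP[c0 cb] := cutr_le x d01.
rewrite -EFinM !abse_EFin lee_fin [leRHS]ger0_norm; last first.
  by rewrite !mulr_ge0 ?enorm_ge0 ?invr_ge0// (le_trans c0).
rewrite !normrM (ger0_norm c0) (ger0_norm (h_ge0 Dx)) normfV normr_nat -!mulrA.
rewrite ler_wpM2l ?invr_ge0// ler_pM ?h_ge0 ?ChP// ?mulr_ge0//.
rewrite ler_pM// (le_trans (normr_dot_le _ _))// mulrC ler_wpM2r ?enorm_ge0//.
exact: CrP.
Qed.

(** By Cauchy-Schwarz [Bd] is at most [fd + wd], whose integral is zero: the first variation formula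
    for the radial field, with its boundary term gone, says that the integral of [fd] is minus that
    of [wd]. *)
Lemma radial_inequality d : 0 < d <= 1 ->
  (forall x, boundary Omega x -> h x * cutr d x = 0) ->
  \int[mu]_(x in D) Bd d x <= 0.
Proof.
move=> d01 hS; have /andP[d0 d1] := d01.
(* The factor 1/m cancels the trace m of the plane in one term and, in the other, the m produced by
   differentiating r^-m. *)
pose g t := m%:R^-1 * profile m r1 a d t.
pose g' t := m%:R^-1 * dprofile m r1 a d t.
have gg' (t : R) : is_derive t 1 g (g' t).
  have := @is_derive_profile _ m r1 a d r1_gt0 d0 t (ltW a_lt_b).
  by move=> D; exact: is_deriveZ.
have cg' : continuous g'.
  move=> t; apply: (@continuousM _ _ (cst m%:R^-1) (dprofile m r1 a d)).
    exact: cst_continuous.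
  exact: continuous_dprofile.
have C1phi := C1_radial_field xi h_C1 gg' cg'.
have phi0 x : boundary Omega x -> radial_field xi h g x = 0.
  move=> Sx; rewrite /radial_field /g mulrCA -/(cutr d x) hS// mulr0 scale0r//.
have tphi : C1_tangential Omega (radial_field xi h g) (dradial_field xi h dh g g').
  (* The zero vector is the velocity of the constant curve at x. *)
  split => // x Sx; rewrite phi0//; exists (cst x); split.
  - by [].
  - by near=> t; case: Sx.
  - exact: is_derive_cst.
have sphi : compactly_supported Omega (radial_field xi h g).
  apply: (subclosed_compact _ kD); first exact: closed_closure.
  rewrite [X in _ `<=` X](closure_id _).1//; apply: closureS.
  by move=> y [Dy _].
have [_ _ _ _ [Gamma [_ _ /(_ _ _ tphi sphi)]]] := capV.
rewrite (first_variation_weight bOmega varV rectV _ (int_fd d01)); last 2 first.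
- by case: C1phi.
- move=> x Dx gT; have TE : T x = TM x.
    by rewrite /plane; case: ifPn => // /negP[]; exact: mem_set.
  have [sT iT _] := gT.
  rewrite (divergence_radial xi h dh g g' x sT iT) TE -TE (grassmannian_trace gT) TE.
  rewrite /fd /g /g' /dprofile -/(profile m r1 a d (dot (x - xi) (x - xi))).
  have m0 : m%:R != 0 :> R by rewrite pnatr_eq0 -lt0n.
  rewrite {1 3}/profile; field.
  by rewrite m0 expf_neq0// gt_eqF// trad_gt0.
rewrite [X in _ - X](_ : _ = 0); last first.
  rewrite /Rintegral (@eq_integral _ _ _ _ _ (cst 0%E)) ?integral0//.
  by move=> [x P] /set_mem [/= Sx _ _ _]; rewrite phi0// dot0r.
rewrite subr0 => EQ.
have wE : \int[mu]_(x in D) dot (H x) (radial_field xi h g x) = \int[mu]_(x in D) wd d x.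
  apply: eq_Rintegral => x _.
  by rewrite dotZr /wd /g /profile; ring.
rewrite wE in EQ.
have : \int[mu]_(x in D) Bd d x <= \int[mu]_(x in D) (fd d x + wd d x).
  apply: le_Rintegral => //; first exact: int_Bd.
    have -> : EFin \o (fun x => fd d x + wd d x) = ((EFin \o fd d) \+ (EFin \o wd d))%E by [].
    by apply: integrableD; [exact: mD|exact: int_fd|exact: int_wd].
  move=> x Dx; have /andP[c0 cb] := cutr_le x d01.
  have e1 : - (enorm (gradient (dh x) *m TM x) * rad x) <=
      dot (gradient (dh x) *m TM x) (x - xi).
    by have := normr_dot_le (gradient (dh x) *m TM x) (x - xi); rewrite ler_norml => /andP[].
  have e2 : - (enorm (H x) * rad x) <= dot (H x) (x - xi).
    by have := normr_dot_le (H x) (x - xi); rewrite ler_norml => /andP[].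
  have mc0 : 0 <= m%:R^-1 * cutr d x by rewrite mulr_ge0 ?invr_ge0.
  have e3 : - (h x * (enorm (H x) * rad x)) <= h x * dot (H x) (x - xi).
    by rewrite -mulrN ler_wpM2l// h_ge0.
  rewrite /Bd /fd /wd /Fint.
  have := ler_wpM2l mc0 (lerD e1 e3).
  set X := h x * (_ - _); lra.
rewrite (RintegralD mD (int_fd d01) (int_wd d01)).
by rewrite EQ addNr.
Unshelve. all: by end_near. Qed.

(** * Passage to the limit in the smoothing parameter *)

Let annulus x : R := if r1 < rad x <= r2 then 1 else 0.

(** The value is attained once d is below the gap between u = r^-m and the threshold above it. At u
    = b both slopes are 1 and cancel, so the sphere of radius r1 is excluded; at u = a the first
    slope is already 1, so the sphere of radius r2 is included. *)
Let dcutr_lim x : \forall d \near 0^'+, dcutr d x = annulus x.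
Proof.
have radpow (s u : R) : 0 <= s -> 0 <= u -> s < u -> s ^+ m < u ^+ m.
  by move=> s0 u0 su; rewrite ltr_pXn2r.
have rx0 := enorm_ge0 (x - xi).
have inv_lt (s u : R) : 0 < s -> s < u -> u ^- m < s ^- m.
  move=> s0 su; have u0 := lt_trans s0 su.
  by rewrite ltf_pV2 ?posrE ?exprn_gt0// radpow// ltW.
rewrite /annulus; have [xr1|r1x] := leP (rad x) r1.
  near=> d; have d0 : 0 < d by near: d; exact: nbhs_right_gt.
  by rewrite tradE max_r// dcut_right// ltW.
have rx_gt0 : 0 < rad x := lt_trans r1_gt0 r1x.
have [xr2|r2x] := leP (rad x) r2.
  have gap : 0 < b - rad x ^- m by rewrite subr_gt0 inv_lt.
  near=> d; have d0 : 0 < d by near: d; exact: nbhs_right_gt.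
  rewrite tradE max_l ?(ltW r1x)//= dcut_mid//.
    by rewrite lef_pV2 ?posrE ?exprn_gt0// ler_pXn2r ?nnegrE// ltW.
  by rewrite -lerBrDl; near: d; exact: nbhs_right_le.
have gap : 0 < a - rad x ^- m by rewrite subr_gt0 inv_lt.
near=> d; have d0 : 0 < d by near: d; exact: nbhs_right_gt.
rewrite tradE max_l ?(ltW r1x)//= dcut_left ?(ltW a_lt_b)//.
by rewrite -lerBrDl; near: d; exact: nbhs_right_le.
Unshelve. all: by end_near. Qed.

Lemma limit_inequality d0 : 0 < d0 ->
  (forall d x, 0 < d <= d0 -> boundary Omega x -> h x * cutr d x = 0) ->
  mu.-integrable D (EFin \o B) /\ \int[mu]_(x in D) B x <= 0.
Proof.
(* The parameters c / (k + 1) stay below d0, where the field vanishes on the boundary, and below 1,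
   where the majorant is valid. *)
move=> d0_gt0 hS; pose c := Num.min d0 1.
have c_gt0 : 0 < c by rewrite lt_min d0_gt0 ltr01.
pose dk (k : nat) := c * k.+1%:R^-1.
have dk_gt0 k : 0 < dk k by rewrite mulr_gt0.
have dk_le k : dk k <= c by rewrite ler_piMr ?(ltW c_gt0)// invf_le1// ler1n.
have dk1 k : 0 < dk k <= 1.
  by rewrite dk_gt0 (le_trans (dk_le k))// ge_min lexx orbT.
have dk0 : dk @ \oo --> 0.
  rewrite -(mulr0 c); apply: cvgM; first exact: cvg_cst.
  exact: cvg_harmonic.
have dk0r : dk @ \oo --> 0^'+.
  move=> P P0; have dkP : \forall k \near \oo, 0 < dk k -> P (dk k) := dk0 _ P0.
  suff : \forall k \near \oo, P (dk k) by [].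
  by apply: filterS dkP => k; apply; exact: dk_gt0.
have cvB x : D x -> (fun k => (Bd (dk k) x)%:E) @ \oo --> (B x)%:E.
  move=> Dx; apply: cvg_EFin; first by near=> k.
  have cc : (fun k => cutr (dk k) x) @ \oo --> clamp a b (trad x ^- m).
    apply/cvgrPdist_le => e e0; near=> k; rewrite distrC.
    apply: (le_trans (cut_clamp _ _ _ (dk_gt0 k))).
    have : `|0 - dk k| <= e by near: k; move: e e0; exact/cvgrPdist_le.
    by rewrite sub0r normrN ger0_norm// ltW.
  have dd : (fun k => dcutr (dk k) x) @ \oo --> annulus x.
    apply: cvg_near_cst; exact: (dk0r _ (dcutr_lim x)).
  apply: cvgB.
    apply: cvgM; first exact: cvg_cst.
    apply: cvgB => //; apply: cvgM; last exact: cvg_cst.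
    by apply: cvgM; [exact: dd|exact: cvg_cst].
  apply: cvgM; last exact: cvg_cst.
  apply: cvgM; last exact: cvg_cst.
  by apply: cvgM; [exact: cvg_cst|exact: cc].
have [G intG BG] := dominated.
have mBk k : measurable_fun (D : set (borel E)) (fun x : borel E => (Bd (dk k) x)%:E).
  by apply/measurable_EFinP; exact: mBd.
have mB : measurable_fun (D : set (borel E)) (fun x : borel E => (B x)%:E).
  exact: (emeasurable_fun_cvg (fun k (x : borel E) => (Bd (dk k) x)%:E)).
have [] := @dominated_convergence _ _ _ mu D mD (fun k x => (Bd (dk k) x)%:E)
  (fun x => (B x)%:E) (fun x => (G x)%:E) mBk mB _ intG _.
- by apply/aeW => x Dx; exact: cvB.
- by apply/aeW => x k Dx; rewrite abse_EFin lee_fin; exact: BG.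
move=> intB _ lim; split => //.
have le0 k : (\int[mu]_(x in D) (Bd (dk k) x)%:E <= 0)%E.
  rewrite -(fineK (integrable_fin_num _ (int_Bd (dk1 k))))// lee_fin.
  apply: radial_inequality => // x Sx; apply: hS => //.
  by rewrite dk_gt0 (le_trans (dk_le k))// ge_min lexx.
rewrite /Rintegral -lee_fin fineK; last exact: (integrable_fin_num mD intB).
rewrite -(cvg_lim _ lim)//; apply: lime_le; first by apply/cvg_ex; eexists; exact: lim.
by near=> k; exact: le0.
Unshelve. all: by end_near. Qed.

(** * Rearrangement into ball masses, defect and error *)

Let ballfun (r : R) (x : E) := if rad x <= r then h x else 0.

(** The truncated radius equals the true one on the annulus, and its negative powers are continuous
    on the whole space. *)
Let defectfun (x : E) := if r1 < rad x <= r2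
  then h x * (enorm ((x - xi) - (x - xi) *m TM x) ^+ 2 * trad x ^- (m + 2)) else 0.

Let errorfun (x : E) := m%:R^-1 * clamp a b (trad x ^- m) * rad x * Fint x.

Let int_ballfun r : mu.-integrable D (EFin \o ballfun r).
Proof.
have [Ch Ch0 ChP] := h_bounded.
apply: (@int_bounded _ Ch) => [|x Dx]; last first.
  by rewrite /ballfun; case: ifP => _; rewrite ?normr0// ger0_norm ?ChP ?h_ge0.
apply: measurable_fun_if => //.
- exact: measurable_fun_ler.
- apply: measurable_funS mh => //; exact: subIsetl.
Qed.

Let clamp_le x : 0 <= clamp a b (trad x ^- m) <= b.
Proof.
have /andP[u0 ub] := trad_le_b x; have a0 := a_gt0; have ab := a_lt_b.
rewrite /clamp (max_r (_ : trad x ^- m - b <= 0)) ?subr_le0// subr0.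
by rewrite le_max lexx orbT/= ge_max; apply/andP; split; lra.
Qed.

Let int_errorfun : mu.-integrable D (EFin \o errorfun).
Proof.
have [Cr Cr0 CrP] := rad_bounded.
have intG : mu.-integrable D (fun x => (m%:R^-1 * b * Cr)%:E * (Fint x)%:E)%E.
  exact: integrableZl.
apply: (le_integrable mD _ _ intG).
  apply/measurable_EFinP; apply: measurable_funM => //; apply: measurable_funM => //.
  apply: measurable_funM => //; apply: measurable_funB;
    by apply: measurable_maxr => //; exact: measurable_funB.
move=> x Dx; have /andP[c0 cb] := clamp_le x.
rewrite -EFinM !abse_EFin lee_fin !normrM ler_wpM2r//.
rewrite (ger0_norm c0) (ger0_norm (enorm_ge0 _)) (ger0_norm Cr0).
rewrite (@ger0_norm _ b) ?invr_ge0 ?exprn_ge0 ?(ltW r1_gt0)//.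
by rewrite !ler_pM ?mulr_ge0 ?enorm_ge0 ?CrP.
Qed.

(** On the annulus r^-m = r^2 r^-(m+2), and [B] subtracts the tangential part of r^2; by Pythagoras
    the normal part remains. In the inner ball the clamp is b - a, and outside radius r2 every term
    vanishes. *)
Let balance x : b * ballfun r1 x + defectfun x = B x + (a * ballfun r2 x + errorfun x).
Proof.
rewrite /ballfun /defectfun /B -/(errorfun x) (enorm_coproj_sqr (plane_sym _ _ _) (plane_idem _ _ _)).
set p := enorm (_ *m _) ^+ 2; rewrite /clamp.
have rx0 := enorm_ge0 (x - xi).
have ab := a_lt_b.
have [xr1|r1x] := leP (rad x) r1.
  have xr2 : rad x <= r2 by rewrite (le_trans xr1)// ltW.
  rewrite xr2 /= tradE (max_r xr1) subrr maxxx max_l ?subr_ge0 ?ltW//; ring.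
have rx_gt0 : 0 < rad x := lt_trans r1_gt0 r1x.
have le_b : rad x ^- m <= b.
  by rewrite lef_pV2 ?posrE ?exprn_gt0// ler_pXn2r ?nnegrE// ltW.
rewrite tradE (max_l (ltW r1x)) (max_r (_ : _ - b <= 0)) ?subr_le0//=.
have [xr2|r2x] := leP (rad x) r2; last first.
  rewrite max_r; first by ring.
  by rewrite subr_le0 lef_pV2 ?posrE ?exprn_gt0// ler_pXn2r ?nnegrE// ltW.
rewrite max_l; last first.
  by rewrite subr_ge0 lef_pV2 ?posrE ?exprn_gt0// ler_pXn2r ?nnegrE// ltW.
have -> : rad x ^- m = rad x ^+ 2 * rad x ^- (m + 2).
  by rewrite exprD invfM mulrCA mulfV ?mulr1// expf_neq0// gt_eqF.
ring.
Qed.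

(** Solved from [balance], whose other terms are integrable. *)
Let int_defectfun : mu.-integrable D (EFin \o B) -> mu.-integrable D (EFin \o defectfun).
Proof.
move=> intB.
have -> : EFin \o defectfun = ((EFin \o B) \+ ((fun x => a%:E * (ballfun r2 x)%:E) \+
    (EFin \o errorfun)) \- (fun x => b%:E * (ballfun r1 x)%:E))%E.
  apply/funext => x /=; rewrite -!EFinM -!EFinD; congr EFin.
  by rewrite -balance; ring.
apply: integrableB => //; last by apply: integrableZl => //; exact: int_ballfun.
apply: integrableD => //; apply: integrableD => //.
by apply: integrableZl => //; exact: int_ballfun.
Qed.

Lemma core_inequality d0 : 0 < d0 ->
  (forall d x, 0 < d <= d0 -> boundary Omega x -> h x * cutr d x = 0) ->
  b * \int[mu]_(x in D) ballfun r1 x + \int[mu]_(x in D) defectfun x <=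
  a * \int[mu]_(x in D) ballfun r2 x + \int[mu]_(x in D) errorfun x.
Proof.
move=> d0_gt0 hS; have [intB leB] := limit_inequality d0_gt0 hS.
have intZ r s : mu.-integrable D (EFin \o (fun x => s * ballfun r x)).
  rewrite (_ : EFin \o _ = fun x => s%:E * (ballfun r x)%:E)%E//.
  by apply: integrableZl => //; exact: int_ballfun.
rewrite -!RintegralZl//; try exact: int_ballfun.
rewrite -(RintegralD mD (intZ _ _) (int_defectfun intB)).
rewrite -(RintegralD mD (intZ _ _) int_errorfun).
have intS : mu.-integrable D (EFin \o (fun x => a * ballfun r2 x + errorfun x)).
  exact: (integrableD mD (intZ r2 a) int_errorfun).
have -> : \int[mu]_(x in D) (b * ballfun r1 x + defectfun x) =
    \int[mu]_(x in D) (B x + (a * ballfun r2 x + errorfun x)).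
  by apply: eq_Rintegral => x _; exact: balance.
by rewrite (RintegralD mD intB intS) gerDr.
Qed.

Lemma cutoff_boundary : Omega xi ->
  (forall x, boundary Omega x -> h x = 0) \/ r2 < signed_dist Omega xi ->
  exists2 d0, 0 < d0 &
    forall d x, 0 < d <= d0 -> boundary Omega x -> h x * cutr d x = 0.
Proof.
move=> Oxi [h0|]; first by exists 1 => // d x _ /h0 ->; rewrite mul0r.
rewrite /signed_dist mem_set//; set s := Defs.edist _ _ => r2s.
have s0 : 0 < s := lt_trans r2_gt0 r2s.
(* This is the gap between radius r2 and the boundary distance s, measured in r^-m. For d up to this
   gap, the cutoff vanishes at all radii at least s, hence on the boundary. *)
exists (a - s ^- m).
  by rewrite subr_gt0 ltf_pV2 ?posrE ?exprn_gt0// ltr_pXn2r ?nnegrE ?ltW.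
move=> d x /andP[d0 da] Sx.
have sx : s <= rad x.
  rewrite -enormN opprB; apply: ge_inf; last by exists x.
  by exists 0 => _ [y _ <-]; exact: enorm_ge0.
rewrite cut_left ?mulr0 ?(ltW a_lt_b)//.
rewrite addrC -lerBrDr (le_trans da)// lerD2l lerN2.
rewrite lef_pV2 ?posrE ?exprn_gt0 ?trad_gt0//.
apply: lerXn2r; rewrite ?nnegrE ?(ltW s0) ?(ltW (trad_gt0 x))//.
by rewrite tradE le_max sx.
Qed.

(** * Return to closed balls, radial shells and the original plane field *)

Let in_eball r x : (x \in eball xi r) = (rad x <= r).
Proof. by apply/idP/idP; rewrite inE. Qed.

Lemma mass_ballfun r : (\int[mu]_(x in eball xi r `&` D) (h x)%:E =
  (\int[mu]_(x in D) ballfun r x)%:E)%E.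
Proof.
rewrite fineK; last exact: (integrable_fin_num mD (int_ballfun r)).
rewrite integral_mkcondl; apply: eq_integral => x _.
by rewrite patchE in_eball /ballfun; case: ifP.
Qed.

Let measurable_rad : measurable_fun [set: borel E] (fun x : borel E => rad x).
Proof.
apply: continuous_borel => x.
exact: (continuous_comp (@continuous_rad x) (@sqrt_continuous _ _)).
Qed.

Let measurable_eball r : measurable (eball xi r : set (borel E)).
Proof.
have := measurable_rad measurableT (measurable_itv `]-oo, r]).
by rewrite setTI; congr measurable; apply/seteqP; split => x /=; rewrite in_itv.
Qed.

Lemma errorfun_le : ((\int[mu]_(x in D) errorfun x)%:E <=
  \int[lebesgue_measure]_(t in `[r1, r2]) ((t ^- m)%:E *
    \int[mu]_(x in eball xi t `&` D) (Fint x)%:E))%E.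
Proof.
(* [Fint] is known to be nonnegative and measurable on the closure only, whereas Tonelli is applied
   on the whole space. *)
pose FD : borel E -> R := Fint \_ D.
have mFD : measurable_fun [set: borel E] FD by exact/(measurable_restrictT _ mD).
have FD0 x : 0 <= FD x.
  by rewrite /FD patchE; case: ifPn => // /set_mem; exact: F_ge0.
have k0 t : r1 <= t <= r2 -> 0 <= t ^- m.
  by move=> /andP[rt _]; rewrite invr_ge0 exprn_ge0// (le_trans _ rt)// ltW.
have [mG tonelli] := tonelli_sublevel (weight_finite bOmega varV) measurable_rad
  mFD FD0 (@measurable_invX _ m r1 r2 r1_gt0) k0.
rewrite [leRHS](_ : _ = \int[mu]_x ((FD x)%:E * \int[lebesgue_measure]_(t in `[r1, r2])
    (t ^- m * (if (rad x <= t)%R then 1 else 0))%:E))%E; last first.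
  rewrite -tonelli; apply: eq_integral => t _; congr (_ * _)%E.
  rewrite integral_mkcondr; apply: eq_integral => x _.
  by rewrite /FD !patchE; case: ifP.
rewrite fineK; last exact: (integrable_fin_num mD int_errorfun).
rewrite integral_mkcond; apply: ge0_le_integral => //.
- move=> x _; rewrite patchE; case: ifPn => // /set_mem Dx.
  have /andP[c0 _] := clamp_le x.
  by rewrite lee_fin !mulr_ge0 ?invr_ge0 ?enorm_ge0 ?F_ge0.
- by apply/(measurable_restrictT _ mD); case/integrableP : int_errorfun.
move=> x _; rewrite /FD !patchE; case: ifPn => [/set_mem Dx|_]; last by rewrite mul0e.
rewrite [leLHS](_ : _ = (Fint x)%:E * (m%:R^-1 * clamp a b (trad x ^- m) * rad x)%:E)%E.
  by apply: lee_wpmul2l; [rewrite lee_fin F_ge0|exact: clamp_shell_le (enorm_ge0 _)].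
by rewrite -EFinM mulrC.
Qed.

Let mTD i j : measurable_fun (D : set (borel E)) (fun x : borel E => T x i j).
Proof. by apply: (@measurable_funS _ _ _ _ setT) => //; exact: measurable_coord. Qed.

Lemma error_plane t :
  (\int[mu]_(x in eball xi t `&` D)
     (h x * enorm (H x) + enorm (gradient (dh x) *m T x))%:E =
   \int[mu]_(x in eball xi t `&` D) (Fint x)%:E)%E.
Proof.
have mQ : measurable (eball xi t `&` D : set (borel E)) by exact: measurableI.
have mFT : measurable_fun (D : set (borel E)) (fun x : borel E =>
    h x * enorm (H x) + enorm (gradient (dh x) *m T x)).
  apply: measurable_funD.
    by apply: measurable_funM => //; exact: measurable_enorm.
  by apply: measurable_enorm => i; apply: measurable_mulmx => // k l; rewrite ord1.
apply: ae_eq_integral => //.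
- by apply/measurable_EFinP; exact: (measurable_funS mD (@subIsetr _ _ _) mFT).
- by apply/measurable_EFinP; exact: (measurable_funS mD (@subIsetr _ _ _) mF).
have [N [mN N0 NE]] := weight_ae_plane varV rectV; exists N; split => //.
by apply: subset_trans NE; apply: subsetC => x /= TE _; rewrite /Fint TE.
Qed.

Lemma defect_plane : mu.-integrable D (EFin \o B) ->
  (\int[mu]_(x in (eball xi r2 `\` eball xi r1) `&` D)
     (h x * (enorm ((x - xi) - (x - xi) *m T x) ^+ 2 / rad x ^+ (m + 2)))%:E =
  (\int[mu]_(x in D) defectfun x)%:E)%E.
Proof.
move=> intB; have mQ : measurable ((eball xi r2 `\` eball xi r1) `&` D : set (borel E)).
  by apply: measurableI => //; exact: measurableD.
pose f (P : E -> M) x :=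
  h x * (enorm ((x - xi) - (x - xi) *m P x) ^+ 2 * trad x ^- (m + 2)).
have mf (P : E -> M) : (forall i j, measurable_fun (D : set (borel E)) (fun x : borel E => P x i j)) ->
    measurable_fun ((eball xi r2 `\` eball xi r1) `&` D : set (borel E)) (EFin \o f P).
  move=> mP; apply/measurable_EFinP.
  suff mfP : measurable_fun (D : set (borel E)) (f P : borel E -> R).
    exact: (measurable_funS mD (@subIsetr _ _ _) mfP).
  apply: measurable_funM => //; apply: measurable_funM => //.
  apply: measurable_funX; apply: measurable_enorm => i.
  under eq_fun do rewrite mxE [(- _ : E) _ _]mxE.
  apply: measurable_funB => //.
  by apply: measurable_mulmx => // k l; rewrite ord1.
(* Outside the closed ball of radius r1 the truncation is inactive, so the true radius may be
   replaced by the continuous kernel before the planes are exchanged almost everywhere. *)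
transitivity (\int[mu]_(x in (eball xi r2 `\` eball xi r1) `&` D) (f T x)%:E)%E.
  apply: eq_integral => x /set_mem [[_ /negP]]; rewrite -ltNge => r1x _.
  by rewrite /f tradE max_l// ltW.
transitivity (\int[mu]_(x in (eball xi r2 `\` eball xi r1) `&` D) (f TM x)%:E)%E.
  apply: ae_eq_integral => //; [exact: mf|exact: mf|].
  have [N [mN N0 NE]] := weight_ae_plane varV rectV; exists N; split => //.
  by apply: subset_trans NE; apply: subsetC => x /= TE _; rewrite /f TE.
rewrite fineK; last exact: (integrable_fin_num mD (int_defectfun intB)).
rewrite integral_mkcondl; apply: eq_integral => x _.
by rewrite patchE in_setD !in_eball -ltNge /defectfun andbC; case: ifP.
Qed.

Lemma monotonicity : Omega xi ->
  (forall x, boundary Omega x -> h x = 0) \/ r2 < signed_dist Omega xi ->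
  let mass (r : R) : \bar R :=
    ((r ^- m)%:E * \int[mu]_(x in eball xi r `&` D) (h x)%:E)%E in
  let error : \bar R :=
    (\int[lebesgue_measure]_(rho in `[r1, r2])
       ((rho ^- m)%:E * \int[mu]_(x in eball xi rho `&` D)
          (h x * enorm (H x) + enorm (gradient (dh x) *m T x))%:E))%E in
  let defect : \bar R :=
    (\int[mu]_(x in (eball xi r2 `\` eball xi r1) `&` D)
       (h x * (enorm ((x - xi) - (x - xi) *m T x) ^+ 2 / rad x ^+ (m + 2)))%:E)%E in
  (mass r1 <= mass r2 + error - defect)%E /\
  (mass r2 + error - defect <= mass r2 + error)%E.
Proof.
move=> Oxi h0; have [d0 d0_gt0 hS] := cutoff_boundary Oxi h0.
have [intB _] := limit_inequality d0_gt0 hS.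
move=> mass error defect.
(* Since the defect is a real number, it can be moved across inequalities of extended reals with no
   finiteness claim about [error]. *)
have defectE : defect = (\int[mu]_(x in D) defectfun x)%:E by exact: defect_plane.
have defect0 : (0 <= defect)%E.
  apply: integral_ge0 => x [_ Dx]; rewrite lee_fin mulr_ge0 ?h_ge0//.
  by rewrite divr_ge0 ?exprn_ge0 ?enorm_ge0.
have errorE : ((\int[mu]_(x in D) errorfun x)%:E <= error)%E.
  apply: (le_trans errorfun_le); rewrite le_eqVlt; apply/orP; left; apply/eqP.
  by apply: eq_integral => t _; rewrite error_plane.
split; last first.
  by rewrite defectE leeBlDr// leeDl// -defectE.
rewrite defectE leeBrDr// /mass !mass_ballfun.
apply: le_trans (leeD2l _ errorE).
by rewrite -!EFinM -!EFinD lee_fin; exact: core_inequality hS.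
Qed.

End monotonicity.
Theorem proposition4p1 (R : realType) (n m : nat)
  (n_ge2 : (2 <= n)%N) (m_range : (1 <= m <= n)%N)
  (Omega : set 'rV[R]_n.+1) (Omega_domain : bounded_C2_domain Omega)
  (beta : 'rV[R]_n.+1 -> R) (beta_C1 : C1_on (boundary Omega) beta)
  (beta_range : forall x, boundary Omega x -> 0 < beta x < pi)
  (V : {measure set (borel ('rV[R]_n.+1 * 'M[R]_n.+1)%type) -> \bar R})
  (H : 'rV[R]_n.+1 -> 'rV[R]_n.+1)
  (V_capillary : capillary_varifold Omega beta m V H)
  (M : set 'rV[R]_n.+1) (theta : 'rV[R]_n.+1 -> R)
  (T : 'rV[R]_n.+1 -> 'M[R]_n.+1)
  (V_rectifiable : rectifiable_varifold Omega m V M theta T)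
  (p : R) (p_ge1 : 1 <= p)
  (H_Lp : (weight V).-integrable (closure Omega)
            (fun x => (enorm (H x) `^ p)%:E))
  (h : 'rV[R]_n.+1 -> R) (dh : 'rV[R]_n.+1 -> 'rV[R]_n.+1 -> R)
  (h_C1 : C1_closure Omega h dh)
  (h_ge0 : forall x, closure Omega x -> 0 <= h x)
  (xi : 'rV[R]_n.+1) (xi_in : Omega xi)
  (r1 r2 : R) (r1_gt0 : 0 < r1) (r1_lt_r2 : r1 < r2)
  (h0_or_r2_small : (forall x, boundary Omega x -> h x = 0) \/
                    r2 < signed_dist Omega xi) :
  let mass (r : R) : \bar R :=
    ((r ^- m)%:E *
     \int[weight V]_(x in eball xi r `&` closure Omega) (h x)%:E)%E in
  let error : \bar R :=
    (\int[lebesgue_measure]_(rho in `[r1, r2])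
       ((rho ^- m)%:E *
        \int[weight V]_(x in eball xi rho `&` closure Omega)
          (h x * enorm (H x) + enorm (gradient (dh x) *m T x))%:E))%E in
  let defect : \bar R :=
    (\int[weight V]_(x in (eball xi r2 `\` eball xi r1) `&` closure Omega)
       (h x * (enorm ((x - xi) - (x - xi) *m T x) ^+ 2
               / enorm (x - xi) ^+ (m + 2)))%:E)%E in
  (mass r1 <= mass r2 + error - defect)%E /\
  (mass r2 + error - defect <= mass r2 + error)%E.
Proof.
have [_ _ _ bOmega _] := Omega_domain; have /andP[m_gt0 _] := m_range.
exact: (monotonicity m_gt0 bOmega V_capillary V_rectifiable h_C1 h_ge0
  r1_gt0 r1_lt_r2 xi_in h0_or_r2_small).
Qed.
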